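(* The function $\tilde\nu(t)$ has the series expansion $$\tilde\nu(t)=\frac{1}{2\sqrt2}\sum_{n=0}^\infty d_{2n}U_{2n}(t).$$ The series converges pointwise for all $t\in(-1,1)$ and in the sense of the function space $L^2\left((-1,1),\sqrt{1-t^2}\,dt\right)$.
   Context: For $x>0$ let $\omega(x)=\sum_{m=1}^\infty(2\pi^2m^4x^2-3\pi m^2x)e^{-\pi m^2x}$. Define $$\nu(x)=\int_0^\infty\frac{\omega(u)}{(u+x)^{3/2}}\,du\quad(x>0),\qquad\tilde\nu(t)=\frac{1}{(1+t)^{3/2}}\,\nu\left(\frac{1-t}{1+t}\right)\quad(|t|<1).$$ For $n\ge0$ define $$d_n=\frac{(3/2)_n}{2^{n-3/2}\,n!}\int_0^\infty\frac{\omega(x)}{(x+1)^{3/2}}\left(\frac{x-1}{x+1}\right)^n{}_2F_1\left(\frac n2+\frac34,\frac n2+\frac54;n+2;\left(\frac{x-1}{x+1}\right)^2\right)dx$$ (an absolutely convergent integral), where $(a)_n=a(a+1)\cdots(a+n-1)$ and ${}_2F_1$ is the Gauss hypergeometric function. $U_n$ denotes the Chebyshev polynomials of the second kind, $U_n(\cos\theta)=\frac{\sin((n+1)\theta)}{\sin\theta}$. *)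

(* Defs.v *)
From HB Require Import structures.
From mathcomp Require Import all_boot all_order all_algebra.
From mathcomp Require Import all_classical all_reals all_analysis.
From mathcomp Require Import ring.
Set Implicit Arguments.
Unset Strict Implicit.
Unset Printing Implicit Defensive.
Import Order.TTheory GRing.Theory Num.Theory.
Import numFieldNormedType.Exports.
Local Open Scope classical_set_scope.
Local Open Scope ring_scope.

Section special_functions.
Context {R : realType}.
Implicit Types a b c x t z : R.

Definition pochhammer a (n : nat) : R := \prod_(i < n) (a + i%:R).

(* The Gauss series; it converges, and [limn] is its sum, when [`|z| < 1] and
   [c] is not a nonpositive integer. *)
Definition hypergeom2F1 a b c z : R :=
  limn (series (fun k : nat =>
    pochhammer a k * pochhammer b k / (pochhammer c k * k`!%:R) * z ^+ k)).

Fixpoint chebyU_pair (n : nat) : {poly R} * {poly R} :=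
  if n is n'.+1 then
    let: (p, q) := chebyU_pair n' in (q, 2%:P * 'X * q - p)
  else (1, 2%:P * 'X).

(* Chebyshev polynomials of the second kind, by the recurrence
   U_0 = 1, U_1 = 2X, U_(n+2) = 2X U_(n+1) - U_n. *)
Definition chebyU (n : nat) : {poly R} := (chebyU_pair n).1.

Lemma chebyU0 : chebyU 0 = 1. Proof. by []. Qed.

Lemma chebyU1 : chebyU 1 = 2%:P * 'X. Proof. by []. Qed.

Lemma chebyUSS n : chebyU n.+2 = 2%:P * 'X * chebyU n.+1 - chebyU n.
Proof. by rewrite /chebyU /=; case: (chebyU_pair n). Qed.

Lemma chebyU_mul_sin n (theta : R) :
  (chebyU n).[cos theta] * sin theta = sin (n.+1%:R * theta).
Proof.
suff: (chebyU n).[cos theta] * sin theta = sin (n.+1%:R * theta) /\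
      (chebyU n.+1).[cos theta] * sin theta = sin (n.+2%:R * theta) by case.
elim: n => [|n [IH1 IH2]].
  rewrite chebyU0 chebyU1 !hornerE; split; first by rewrite ?mul1r.
  by rewrite [2%:R * theta]mulr_natl [theta *+ 2]mulr2n sinD; ring.
split=> //; rewrite chebyUSS.
have -> : (2%:P * 'X * chebyU n.+1 - chebyU n).[cos theta] * sin theta =
    2 * cos theta * ((chebyU n.+1).[cos theta] * sin theta) -
    (chebyU n).[cos theta] * sin theta.
  by rewrite hornerD hornerN !hornerM hornerC hornerX; ring.
rewrite IH1 IH2.
have -> : n.+3%:R * theta = n.+2%:R * theta + theta.
  by rewrite -[n.+3]addn1 natrD mulrDl mul1r.
have -> : n.+1%:R * theta = n.+2%:R * theta - theta.
  by rewrite -[n.+2]addn1 natrD mulrDl mul1r addrK.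
by rewrite !sinD sinN cosN; ring.
Qed.

Lemma chebyU_cos n (theta : R) : sin theta != 0 ->
  (chebyU n).[cos theta] = sin (n.+1%:R * theta) / sin theta.
Proof. by move=> s0; rewrite -chebyU_mul_sin mulfK. Qed.

End special_functions.

Section expansion.
Context {R : realType}.
Implicit Types x t : R.

Local Notation mu := (@lebesgue_measure R).

(* The term of index [k] is the one with m = k + 1. *)
Definition omega x : R :=
  limn (series (fun k : nat =>
    (2 * pi ^+ 2 * k.+1%:R ^+ 4 * x ^+ 2 - 3 * pi * k.+1%:R ^+ 2 * x)
    * expR (- pi * k.+1%:R ^+ 2 * x))).

Definition nu x : R :=
  \int[mu]_(u in `]0%R, +oo[) (omega u / (u + x) `^ (3 / 2)).

Definition tnu t : R :=
  ((1 + t) `^ (3 / 2))^-1 * nu ((1 - t) / (1 + t)).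

Definition dcoef (n : nat) : R :=
  pochhammer (3 / 2) n / (2 `^ (n%:R - 3 / 2) * n`!%:R) *
  \int[mu]_(x in `]0%R, +oo[)
    (omega x / (x + 1) `^ (3 / 2) * ((x - 1) / (x + 1)) ^+ n *
     hypergeom2F1 (n%:R / 2 + 3 / 4) (n%:R / 2 + 5 / 4) (n%:R + 2)
                  (((x - 1) / (x + 1)) ^+ 2)).

(* The sum of the terms of index n < N. *)
Definition cheby_partial_sum (N : nat) t : R :=
  (2 * Num.sqrt 2)^-1 *
  \sum_(0 <= n < N) dcoef n.*2 * (chebyU n.*2).[t].

(* The norm of L^2((-1,1), sqrt(1 - t^2) dt), with values in [0, +oo]. *)
Definition chebyL2norm (f : R -> R) : \bar R :=
  ((\int[mu]_(t in `](-1)%R, 1%R[) (`|f t| ^+ 2 * Num.sqrt (1 - t ^+ 2))%:E)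
   `^ 2^-1)%E.

Definition in_chebyL2 (f : R -> R) : Prop :=
  measurable_fun (`]-1, 1[%classic : set R) f /\ (chebyL2norm f < +oo)%E.

End expansion.

(* Main.v *)
Require Import Defs.
From mathcomp Require Import all_boot all_order all_algebra.
From mathcomp Require Import all_classical all_reals all_analysis.
From mathcomp Require Import measurable_realfun ring lra zify.
Set Implicit Arguments.
Unset Strict Implicit.
Unset Printing Implicit Defensive.
Import Order.TTheory GRing.Theory Num.Theory.
Import numFieldNormedType.Exports.
Local Open Scope classical_set_scope.
Local Open Scope ring_scope.

(** Put [s = (x - 1) / (x + 1)] ([mobius]) and [w = omega x / (x + 1) `^ (3 / 2)]
    ([omega_weight]).  Clearing denominators gives
    [tnu t = \int w (1 + t s) `^ (- 3 / 2)] over the positive reals, and expanding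
    the power by the binomial series gives [tnu t = \sum_k b_k m_k (- t)^k], where
    [b_k = (3/2)_k / k!] and [m_k = \int w s^k].

    Two properties of [omega] are needed.  The product
    [w (1 - |s|) `^ (- 3 / 2)] is integrable, which gives
    [\sum_k b_k |m_k| < oo] ([is_cvg_binom_moment]); and [w dx] is invariant under
    [x -> 1 / x] while [s] changes sign, so that [m_k = 0] for odd [k]
    ([moment_odd]).  Both follow from [omega x^-1 = sqrt x * omega x]
    ([omega_inv]): the decay of [omega] at infinity is visible on its series, and
    the inversion carries it to [0].

    The formula [omega_inv] is the second derivative of the inversion formula of
    the theta function, and the latter is obtained by the method of Polya.  The sum
    of [cos (pi j / q)^(2m)] over [j < q] is computed in two ways
    ([polya_identity]): directly, and from the binomial expansion, where only the
    frequencies divisible by [q] survive.  When [q^2 / m] tends to [pi x], both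
    sides become theta series by Tannery's theorem.  The limit of the factor
    [q C(2m, m) / 4^m] is found by symmetry: its square is proportional to [x], and
    the case [x = 1] gives the constant.

    For the expansion itself, [t^(2i)] is a combination of the [U_(2l) t], [l <= i],
    with the nonnegative coefficients [ballot i l] ([expr_chebyU]), and the
    coefficient of [U_(2l)] in the theorem is [\sum_i ballot i l * a_i] with
    [a_i = b_(2i) m_(2i)] ([cvg_dcoef]).  At [t = 1] one has [U_n 1 = n + 1], hence
    [\sum_l ballot i l * (2l + 1) = 1]; since [|U_n t| <= n + 1], the partial sum of
    order [N] treats each [a_i] with [i < N] exactly and each later one with an
    error at most [2 |a_i|] ([cheby_partial_sum_close]).  The error is therefore at
    most [2 \sum_(i >= N) |a_i|], uniformly in [t], which gives both the pointwise
    convergence and the convergence in norm. *)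

(** * Series with a convergent majorant *)

Lemma is_cvg_series_dominated (R : realType) (u g : nat -> R) :
  cvgn (series g) -> (forall j, `|u j| <= g j) -> cvgn (series u).
Proof.
move=> cg ug; apply: normed_cvg; apply: (series_le_cvg _ _ ug cg) => j.
  exact: normr_ge0.
by apply: le_trans (ug j); exact: normr_ge0.
Qed.

Lemma series_tail_le (R : realType) (u g : nat -> R) J :
  cvgn (series g) -> (forall j, `|u j| <= g j) ->
  `|limn (series u) - series u J| <= limn (series g) - series g J.
Proof.
move=> cg ug; have cu := is_cvg_series_dominated cg ug.
have cu' : (`|series u n - series u J| @[n --> \oo]) -->
    `|limn (series u) - series u J|.
  by apply: cvg_norm; apply: cvgB => //; exact: cvg_cst.
have cg' : (series g n - series g J @[n --> \oo]) -->
    limn (series g) - series g J.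
  by apply: cvgB => //; exact: cvg_cst.
apply: (ler_cvg_to cu' cg'); near=> n.
have Jn : (J <= n)%N by near: n; exists J.
rewrite !sub_series_geq//; apply: (le_trans (ler_norm_sum _ _ _)).
exact: ler_sum.
Unshelve. all: by end_near. Qed.

(** Tannery's theorem for sums whose number of terms grows with [p]: beyond a
    fixed rank, all the sums are controlled by the tail of [series g]. *)
Lemma cvg_sum_tannery (R : realType) (f : nat -> nat -> R) (F g : nat -> R)
    (N : nat -> nat) :
  cvgn (series g) ->
  (\forall p \near \oo, forall j, (j < N p)%N -> `|f p j| <= g j) ->
  N p @[p --> \oo] --> \oo ->
  (forall j, f p j @[p --> \oo] --> F j) ->
  \sum_(0 <= j < N p) f p j @[p --> \oo] --> limn (series F).
Proof.
move=> cg fg Noo fF.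
have Nge J : \forall p \near \oo, (J <= N p)%N.
  by apply: (Noo [set n | (J <= n)%N]); exists J.
have Fg j : `|F j| <= g j.
  have c : `|f p j| @[p --> \oo] --> `|F j| by apply: cvg_norm.
  apply: (cvgr_to_le c); near=> p; have H := near fg p; apply: H => //.
  by near: p; exact: Nge.
apply/cvgrPdist_le => e e0.
have e30 : 0 < e / 3 by rewrite divr_gt0.
have : \forall J \near \oo, `|limn (series g) - series g J| <= e / 3.
  by move/cvgrPdist_le : cg; apply.
case=> J _ /(_ J) /= /(_ (leqnn J)) gJ.
have tg : limn (series g) - series g J <= e / 3.
  by apply: le_trans gJ; exact: ler_norm.
have g0 j : 0 <= g j by apply: le_trans (Fg j); exact: normr_ge0.
have cJ : \sum_(0 <= j < J) f p j @[p --> \oo] --> series F J.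
  rewrite /series /=; elim: J {gJ tg} => [|J IH].
    rewrite big_geq//; under eq_fun do rewrite big_geq//; exact: cvg_cst.
  rewrite big_nat_recr//=; under eq_fun do rewrite big_nat_recr//=.
  by apply: cvgD.
near=> p.
have JN : (J <= N p)%N by near: p; exact: Nge.
rewrite (big_cat_nat (leq0n J) JN)//= opprD addrA.
have -> : limn (series F) - \sum_(0 <= i < J) f p i - \sum_(J <= i < N p) f p i =
  (limn (series F) - series F J) + (series F J - \sum_(0 <= i < J) f p i)
    - \sum_(J <= i < N p) f p i by ring.
apply: (le_trans (ler_normB _ _)).
have -> : e = e / 3 + e / 3 + e / 3 by field.
apply: lerD; first (apply: (le_trans (ler_normD _ _)); apply: lerD).
- by apply: le_trans tg; exact: series_tail_le.
- by near: p; move/cvgrPdist_le : cJ; apply.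
apply: (le_trans (ler_norm_sum _ _ _)).
apply: (@le_trans _ _ (\sum_(J <= i < N p) g i)).
  rewrite !big_seq; apply: ler_sum => j; rewrite mem_index_iota => /andP[_ jN].
  by have H := near fg p; apply: H.
rewrite -sub_series_geq//; apply: le_trans tg; rewrite lerD2r.
apply: nondecreasing_cvgn_le => //; apply/nondecreasing_seqP => n.
by rewrite seriesSr lerDl.
Unshelve. all: by end_near. Qed.

(** * A finite form of the theta inversion *)

Lemma sum_sym_nat (V : nmodType) (m : nat) (F : nat -> V) :
  \sum_(0 <= k < m.*2.+1) F k =
  F m + \sum_(0 <= i < m) (F (m - i.+1)%N + F (m + i.+1)%N).
Proof.
rewrite (@big_cat_nat _ _ _ m)//=; last by lia.
rewrite addrC -{1}(add0n m) big_addn big_ltn; last by lia.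
rewrite add0n -addrA; congr (_ + _).
have -> : (m.*2.+1 - m = m.+1)%N by lia.
rewrite big_add1 /= big_split /= addrC; congr (_ + _).
  rewrite big_nat_rev /=; apply: eq_big_nat => i /andP[_ im].
  by rewrite add0n.
by apply: eq_bigr => i _; rewrite addnC.
Qed.

Lemma cos_mul2 (R : realType) (a b : R) :
  2 * cos a * cos b = cos (b + a) + cos (b - a).
Proof. rewrite cosD cosB; ring. Qed.

Lemma cosX_binomial (R : realType) n (y : R) :
  2 ^+ n * cos y ^+ n =
  \sum_(0 <= k < n.+1) 'C(n, k)%:R * cos ((n%:R - 2 * k%:R) * y).
Proof.
elim: n => [|n IH].
  by rewrite big_nat1 !expr0 bin0 mulr0 subr0 mul0r cos0.
rewrite !exprS mulrACA IH big_distrr /=.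
pose a k := cos ((n.+1%:R - 2 * k%:R) * y).
transitivity (\sum_(0 <= k < n.+1) 'C(n, k)%:R * a k +
              \sum_(0 <= k < n.+1) 'C(n, k)%:R * a k.+1).
  rewrite -big_split; apply: eq_bigr => k _ /=.
  rewrite mulrCA cos_mul2 -mulrDr /a; congr (_ * (cos _ + cos _)).
    by rewrite -[n.+1]addn1 natrD; ring.
  by rewrite -[n.+1]addn1 -[k.+1]addn1 !natrD; ring.
rewrite [RHS]big_nat_recl// bin0.
under [in RHS]eq_bigr do rewrite binS natrD mulrDl.
rewrite big_split /= addrA; congr (_ + _).
by rewrite big_nat_recl// bin0 big_nat_recr//= bin_small// mul0r addr0.
Qed.

Lemma cosX2_binomial (R : realType) m (y : R) :
  4 ^+ m * cos y ^+ m.*2 = 'C(m.*2, m)%:R +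
  2 * \sum_(0 <= i < m) 'C(m.*2, m + i.+1)%:R * cos (2 * i.+1%:R * y).
Proof.
have -> : 4 ^+ m = 2 ^+ m.*2 :> R by rewrite -mul2n exprM expr2 -natrM.
rewrite cosX_binomial sum_sym_nat; congr (_ + _).
  by rewrite -mul2n natrM subrr mul0r cos0 mulr1.
rewrite big_distrr /=; apply: eq_big_nat => i /andP[_ im].
have -> : 'C(m.*2, m - i.+1) = 'C(m.*2, m + i.+1).
  by rewrite -bin_sub; [congr 'C(_, _); lia|lia].
have -> : (m.*2%:R - 2 * (m - i.+1)%:R) * y = 2 * i.+1%:R * y.
  by rewrite natrB// -mul2n natrM; ring.
have -> : (m.*2%:R - 2 * (m + i.+1)%:R) * y = - (2 * i.+1%:R * y).
  by rewrite natrD -mul2n natrM; ring.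
by rewrite cosN; ring.
Qed.

Lemma cos_nat2pi (R : realType) k : cos (2 * k%:R * pi) = 1 :> R.
Proof.
have c : cos (0 + pi *+ 2 *+ k) = 1 :> R by rewrite (periodicn (@cosD2pi R)) cos0.
rewrite -[RHS]c add0r -(mulr_natl (pi *+ 2)) -(mulr_natl pi 2).
by congr cos; ring.
Qed.

Lemma sin_natpi_neq0 (R : realType) (k q : nat) : (0 < q)%N -> ~~ (q %| k)%N ->
  sin (k%:R / q%:R * pi) != 0 :> R.
Proof.
move=> q0 qk; have q0' : q%:R != 0 :> R by rewrite pnatr_eq0 -lt0n.
have -> : k%:R / q%:R * pi = (k %% q)%:R / q%:R * pi + pi *+ (k %/ q) :> R.
  by rewrite {1}(divn_eq k q) natrD natrM -(mulr_natl pi); field.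
rewrite (alternatingn (@sinDpi R)) mulf_neq0 ?signr_eq0//.
rewrite gt_eqF// sin_gt0_pi//; apply/andP; split.
  by rewrite mulr_gt0 ?pi_gt0// divr_gt0 ?ltr0n// lt0n.
rewrite gtr_pMl ?pi_gt0// ltr_pdivrMr ?ltr0n// mul1r ltr_nat.
exact: ltn_pmod.
Qed.

(** Orthogonality of the characters of Z/q, by telescoping after
    multiplication by [sin (pi k / q)]. *)
Lemma sum_cos_dvdn (R : realType) (k q : nat) : (0 < q)%N ->
  \sum_(0 <= j < q) cos (2 * k%:R * (j%:R / q%:R * pi)) =
  (if (q %| k)%N then q%:R else 0) :> R.
Proof.
move=> q0; have q0' : q%:R != 0 :> R by rewrite pnatr_eq0 -lt0n.
case: ifPn => [/dvdnP[d ->]|qk].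
  transitivity (\sum_(0 <= j < q) (1 : R)); last first.
    by rewrite sumr_const_nat subn0.
  apply: eq_bigr => j _; rewrite -[RHS](cos_nat2pi R (d * j)); congr cos.
  by rewrite !natrM; field.
pose a : R := k%:R / q%:R * pi.
have s0 : 2 * sin a != 0 by rewrite mulf_neq0// sin_natpi_neq0.
apply: (mulfI s0); rewrite mulr0 big_distrr /=.
rewrite (eq_bigr (fun j => sin (2 * j.+1%:R * a - a) - sin (2 * j%:R * a - a))).
  rewrite telescope_sumr// mulr0 mul0r sub0r.
  have -> : 2 * q%:R * a - a = - a + pi *+ 2 *+ k.
    by rewrite -(mulr_natl (pi *+ 2)) -(mulr_natl pi 2) /a; field.
  by rewrite (periodicn (@sinD2pi R)) subrr.
move=> j _.
have -> : 2 * k%:R * (j%:R / q%:R * pi) = 2 * j%:R * a by rewrite /a; ring.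
have -> : 2 * j.+1%:R * a - a = 2 * j%:R * a + a.
  by rewrite -[j.+1]addn1 natrD; ring.
by rewrite sinD sinB; ring.
Qed.

Lemma sum_dvdn (V : nmodType) (q N : nat) (G : nat -> V) : (0 < q)%N ->
  \sum_(0 <= i < N * q) (if (q %| i.+1)%N then G i.+1 else 0) =
  \sum_(0 <= l < N) G (l.+1 * q)%N.
Proof.
move=> q0; elim: N => [|N IH]; first by rewrite mul0n !big_geq.
rewrite [RHS]big_nat_recr//= -IH mulSn addnC.
rewrite (@big_cat_nat _ _ _ (N * q))//= ?leq_addr//; congr (_ + _).
rewrite -{1}(add0n (N * q)%N) big_addn addKn.
case: q q0 {IH} => // q _; rewrite big_nat_recr//=.
rewrite big1_seq ?add0r => [|i]; last first.
  rewrite mem_index_iota => /andP[_ /andP[_ iq]]; case: ifPn => //.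
  by rewrite -addSn dvdn_addl ?dvdn_mull// => /dvdn_leq; lia.
have -> : (q + N * q.+1).+1 = (N * q.+1 + q.+1)%N by lia.
by rewrite -mulSnr dvdn_mull.
Qed.

Definition central_binomial (R : realType) (m : nat) : R :=
  'C(m.*2, m)%:R / 4 ^+ m.

Definition binomial_ratio (R : realType) (m k : nat) : R :=
  'C(m.*2, m + k)%:R / 'C(m.*2, m)%:R.

Lemma central_bin_neq0 (R : realType) m : 'C(m.*2, m)%:R != 0 :> R.
Proof. by rewrite pnatr_eq0 -lt0n bin_gt0 -addnn leq_addr. Qed.

(** With [q = 2 p + 1], both sides are the sum of [cos (pi j / q) ^+ (2 m)] over
    [j < q]: on the left it is folded by [j -> q - j], on the right it comes from
    the binomial expansion, of which orthogonality keeps the frequencies that are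
    multiples of [q]. *)
Lemma polya_identity (R : realType) (m p : nat) :
  1 + 2 * \sum_(0 <= j < p) cos (j.+1%:R / p.*2.+1%:R * pi) ^+ m.*2 =
  p.*2.+1%:R * central_binomial R m *
    (1 + 2 * \sum_(0 <= l < m) binomial_ratio R m (l.+1 * p.*2.+1)).
Proof.
set q := p.*2.+1; have q0 : (0 < q)%N by [].
have q0' : q%:R != 0 :> R by rewrite pnatr_eq0 -lt0n.
have C0 := central_bin_neq0 R m.
transitivity (\sum_(0 <= j < q) (cos (j%:R / q%:R * pi) : R) ^+ m.*2).
  rewrite big_nat_recl// !mul0r cos0 expr1n; congr (_ + _).
  rewrite -(addnn p).
  rewrite [RHS](@big_cat_nat _ _ _ p)//= ?leq_addr// (mulrDl 1 1) mul1r.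
  congr (_ + _).
  rewrite -[X in _ = \sum_(X <= i < _) _](add0n p) big_addn addnK [RHS]big_nat_rev /=.
  apply: eq_big_nat => i /andP[_ ip]; rewrite add0n.
  have -> : (p - i.+1 + p).+1%:R / q%:R * pi = pi - i.+1%:R / q%:R * pi :> R.
    have -> : (p - i.+1 + p).+1 = (q - i.+1)%N by rewrite /q; lia.
    by rewrite natrB; [field|rewrite /q; lia].
  rewrite cosB cospi sinpi mul0r addr0 mulN1r.
  by rewrite -mul2n !exprM sqrrN.
have F0 : 4 ^+ m != 0 :> R by rewrite expf_neq0.
apply: (mulfI F0).
transitivity (q%:R * ('C(m.*2, m)%:R +
  2 * \sum_(0 <= l < m) 'C(m.*2, m + l.+1 * q)%:R) : R); last first.
  rewrite (eq_bigr (fun l => 'C(m.*2, m)%:R * binomial_ratio R m (l.+1 * q)%N)).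
    by rewrite -big_distrr /= /central_binomial; field.
  by move=> l _; rewrite /binomial_ratio mulrCA mulfV ?mulr1.
rewrite big_distrr /=; under eq_bigr do rewrite cosX2_binomial.
rewrite big_split /= sumr_const_nat subn0 mulrDr mulr_natl; congr (_ + _).
rewrite -big_distrr /= mulrCA; congr (_ * _).
rewrite exchange_big_nat /=.
transitivity (\sum_(0 <= i < m)
    (if (q %| i.+1)%N then q%:R * 'C(m.*2, m + i.+1)%:R else 0 : R)).
  apply: eq_bigr => i _; rewrite -big_distrr /= sum_cos_dvdn//.
  by case: ifP => _; rewrite ?mulr0// mulrC.
rewrite big_distrr /= -(sum_dvdn m (fun i => q%:R * 'C(m.*2, m + i)%:R))//.
rewrite [RHS](@big_cat_nat _ _ _ m)//= ?leq_pmulr// [X in _ = _ + X]big1_seq ?addr0//.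
move=> i; rewrite mem_index_iota => /andP[_ /andP[mi _]].
by rewrite bin_small ?mulr0 ?if_same//; lia.
Qed.

(** * Bounds for binomial ratios and powers of cosines *)

Lemma central_binS m :
  (m.+1 * 'C(m.+1.*2, m.+1) = 2 * m.*2.+1 * 'C(m.*2, m))%N.
Proof.
have h1 := mul_bin_diag m.+1.*2 m; have h2 := mul_bin_diag m.*2.+1 m.
have h3 : 'C(m.*2.+1, m) = 'C(m.*2.+1, m.+1).
  by rewrite -(@bin_sub m.*2.+1 m.+1); [congr 'C(_, _); lia|lia].
rewrite /= h3 in h1 h2; rewrite -h1 -mulnA h2; lia.
Qed.

(** [m (C(2m, m) / 4^m)^2] increases while [(2m + 1) (C(2m, m) / 4^m)^2]
    decreases. *)
Lemma is_cvg_central_binomial (R : realType) :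
  cvgn (fun m => central_binomial R m ^+ 2 * m%:R).
Proof.
have cbS m : central_binomial R m.+1 =
    central_binomial R m * (2 * m%:R + 1) / (2 * m%:R + 2).
  have := congr1 (fun n => n%:R : R) (central_binS m).
  have d : m.*2%:R = 2 * m%:R :> R by rewrite -mul2n natrM.
  rewrite /central_binomial exprS !natrM -(natr1 m) -(natr1 m.*2) d => h.
  have m0 : 0 <= m%:R :> R by [].
  have m1 : m%:R + 1 != 0 :> R by rewrite gt_eqF//; lra.
  have m2 : 2 * m%:R + 2 != 0 :> R by rewrite gt_eqF//; lra.
  have p0 : 4 ^+ m != 0 :> R by rewrite expf_neq0.
  apply: (mulfI m1); rewrite mulrA h; field.
  by rewrite p0 andbT.
have b1 m : central_binomial R m ^+ 2 * (2 * m%:R + 1) <= 1.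
  elim: m => [|m IH].
    by rewrite /central_binomial bin0 expr0 !divr1 expr1n mul1r mulr0 add0r.
  apply: le_trans IH; rewrite cbS -(natr1 m).
  rewrite -mulrA exprMn -mulrA ler_wpM2l ?sqr_ge0//.
  have m0 : 0 <= m%:R :> R by [].
  rewrite expr_div_n mulrAC ler_pdivrMr ?exprn_gt0//.
  by nra.
apply: nondecreasing_is_cvgn.
  apply/nondecreasing_seqP => m; rewrite cbS -(natr1 m).
  move: (central_binomial R m) => c; have m0 : 0 <= m%:R :> R by [].
  rewrite -(mulrA c) exprMn -[leRHS]mulrA ler_wpM2l ?sqr_ge0//.
  rewrite expr_div_n mulrAC ler_pdivlMr ?exprn_gt0//.
  by nra.
exists 1 => _ [m _ <-]; apply: le_trans (b1 m).
rewrite ler_wpM2l ?sqr_ge0//; have m0 : 0 <= m%:R :> R by [].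
by lra.
Qed.

Lemma binomial_ratio0 (R : realType) m : binomial_ratio R m 0 = 1.
Proof. by rewrite /binomial_ratio addn0 divff// central_bin_neq0. Qed.

Lemma binomial_ratio_ge0 (R : realType) m k : 0 <= binomial_ratio R m k.
Proof. by rewrite /binomial_ratio divr_ge0. Qed.

Lemma binomial_ratio_small (R : realType) m k : (m < k)%N ->
  binomial_ratio R m k = 0.
Proof. by move=> mk; rewrite /binomial_ratio bin_small ?mul0r//; lia. Qed.

Lemma binomial_ratioS (R : realType) m k : (k < m)%N ->
  binomial_ratio R m k.+1 =
  binomial_ratio R m k * ((m%:R - k%:R) / (m%:R + k%:R + 1)).
Proof.
move=> km; have := congr1 (fun n => n%:R : R) (mul_bin_left m.*2 (m + k)).
rewrite /binomial_ratio addnS !natrM -natr1.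
have -> : (m.*2 - (m + k) = m - k)%N by lia.
rewrite natrB 1?ltnW// natrD => h.
have mk : m%:R + k%:R + 1 != 0 :> R by rewrite -natrD natr1 pnatr_eq0.
apply: (mulfI mk); rewrite mulrA h; field.
by rewrite mk central_bin_neq0.
Qed.

(** Each factor [(m - i) / (m + i + 1)] of the ratio is [1 - t] with
    [t = (2 i + 1) / (m + i + 1)], and [1 - t <= expR (- t)].  The numerators add up
    to [k ^+ 2], and the denominators are at most [m + k]. *)
Lemma binomial_ratio_le (R : realType) m k : (k <= m)%N ->
  binomial_ratio R m k <= expR (- (k%:R ^+ 2 / (m%:R + k%:R))).
Proof.
move=> km; suff H i : (i <= k)%N ->
    binomial_ratio R m i <= expR (- (i%:R ^+ 2 / (m%:R + k%:R))) by exact: H.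
elim: i => [_|i IH ik]; first by rewrite binomial_ratio0 expr0n/= mul0r oppr0 expR0.
have im : (i < m)%N by apply: leq_trans km.
rewrite binomial_ratioS//.
have -> : expR (- (i.+1%:R ^+ 2 / (m%:R + k%:R))) =
    expR (- (i%:R ^+ 2 / (m%:R + k%:R))) *
    expR (- ((2 * i%:R + 1) / (m%:R + k%:R))) :> R.
  by rewrite -expRD -natr1; congr expR; ring.
have i0 : 0 <= i%:R :> R by [].
have im' : i%:R + 1 <= m%:R :> R by rewrite natr1 ler_nat.
have ik' : i%:R + 1 <= k%:R :> R by rewrite natr1 ler_nat.
apply: ler_pM; rewrite ?binomial_ratio_ge0//.
- by rewrite divr_ge0//; lra.
- by apply: IH; exact: ltnW.
apply: le_trans (expR_ge1Dx _).
rewrite ler_pdivrMr; last lra.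
rewrite -subr_ge0.
have -> : (1 + - ((2 * i%:R + 1) / (m%:R + k%:R))) * (m%:R + i%:R + 1) - (m%:R - i%:R) =
  (2 * i%:R + 1) * (k%:R - i%:R - 1) / (m%:R + k%:R) :> R.
  by field; rewrite gt_eqF//; lra.
by rewrite divr_ge0 ?mulr_ge0//; lra.
Qed.

(** The reciprocal of each factor is [1 + t] with [t = (2 i + 1) / (m - i)], at
    most [expR t], and here the denominators are at least [m - k + 1]. *)
Lemma binomial_ratio_ge (R : realType) m k : (k <= m)%N ->
  expR (- (k%:R ^+ 2 / (m%:R - k%:R + 1))) <= binomial_ratio R m k.
Proof.
move=> km; suff H i : (i <= k)%N ->
    expR (- (i%:R ^+ 2 / (m%:R - k%:R + 1))) <= binomial_ratio R m i by exact: H.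
elim: i => [_|i IH ik]; first by rewrite binomial_ratio0 expr0n/= mul0r oppr0 expR0.
have im : (i < m)%N by apply: leq_trans km.
rewrite binomial_ratioS//.
have -> : expR (- (i.+1%:R ^+ 2 / (m%:R - k%:R + 1))) =
    expR (- (i%:R ^+ 2 / (m%:R - k%:R + 1))) *
    expR (- ((2 * i%:R + 1) / (m%:R - k%:R + 1))) :> R.
  by rewrite -expRD -natr1; congr expR; ring.
have i0 : 0 <= i%:R :> R by [].
have im' : i%:R + 1 <= m%:R :> R by rewrite natr1 ler_nat.
have ik' : i%:R + 1 <= k%:R :> R by rewrite natr1 ler_nat.
have km' : k%:R <= m%:R :> R by rewrite ler_nat.
apply: ler_pM; rewrite ?expR_ge0//; first by apply: IH; exact: ltnW.
rewrite expRN -[leRHS]invrK lef_pV2 ?posrE ?expR_gt0 ?invr_gt0 ?divr_gt0//; try lra.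
apply: le_trans (expR_ge1Dx _); rewrite invf_div ler_pdivrMr; last lra.
rewrite -subr_ge0.
have -> : (1 + (2 * i%:R + 1) / (m%:R - k%:R + 1)) * (m%:R - i%:R) -
    (m%:R + i%:R + 1) =
  (2 * i%:R + 1) * (k%:R - i%:R - 1) / (m%:R - k%:R + 1) :> R.
  by field; rewrite gt_eqF//; lra.
by rewrite divr_ge0 ?mulr_ge0//; lra.
Qed.

Lemma sin_le_id (R : realType) (y : R) : 0 <= y -> sin y <= y.
Proof.
rewrite le_eqVlt => /predU1P[<-|y0]; first by rewrite sin0.
have [x _] := @MVT R sin cos 0 y y0 (fun x _ => is_derive_sin x)
  (continuous_subspaceT (@continuous_sin R)).
rewrite sin0 !subr0 => ->; rewrite ler_piMl ?cos_le1//; exact: ltW.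
Qed.

Lemma mul_cos_le_sin (R : realType) (y : R) : 0 <= y <= pi -> y * cos y <= sin y.
Proof.
move=> /andP[]; rewrite le_eqVlt => /predU1P[<-|y0 ypi]; first by rewrite mul0r sin0.
have [x] := @MVT R sin cos 0 y y0 (fun x _ => is_derive_sin x)
  (continuous_subspaceT (@continuous_sin R)).
rewrite in_itv/= => /andP[x0 xy].
have xI : x \in `[0, pi] by rewrite in_itv/= (ltW x0) (le_trans (ltW xy)).
have yI : y \in `[0, pi] by rewrite in_itv/= (ltW y0).
rewrite sin0 !subr0 => ->; rewrite mulrC ler_pM2r// ltW//.
by rewrite (ltr_cos xI yI).
Qed.

(** By doubling the angle, [sin y >= y cos (y / 2) ^+ 2], and the squared cosine
    is at least [1 / 2]. *)
Lemma half_le_sin (R : realType) (y : R) : 0 <= y <= pi / 2 -> y / 2 <= sin y.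
Proof.
move=> /andP[y0 ypi]; have pi0 := @pi_gt0 R.
have h : y / 2 * cos (y / 2) <= sin (y / 2).
  by apply: mul_cos_le_sin; apply/andP; split; lra.
have c0 : 0 <= cos (y / 2) by apply: cos_ge0_pihalf; apply/andP; split; lra.
have c1 : 0 <= cos y by apply: cos_ge0_pihalf; apply/andP; split; lra.
have yE : y = (y / 2) *+ 2 by rewrite mulr2n; field.
have := cos_mulr2n (y / 2); have := sin_mulr2n (y / 2); rewrite -yE => -> e.
rewrite {}e mulr2n in c1 *.
have := ler_wpM2l c0 h; rewrite mulrCA -expr2 => h'.
by nra.
Qed.

Lemma cosX2_le (R : realType) m (y : R) : cos y ^+ m.*2 <= expR (- (m%:R * sin y ^+ 2)).
Proof.
rewrite -mul2n exprM -mulrN expRM_natl; apply: lerXn2r; rewrite ?nnegrE ?sqr_ge0 ?expR_ge0//.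
by rewrite cos2sin2; exact: expR_ge1Dx.
Qed.

(** [cos^-2 = 1 + tan^2] is at most the exponential of [tan^2]. *)
Lemma cosX2_ge (R : realType) m (y : R) : cos y != 0 ->
  expR (- (m%:R * tan y ^+ 2)) <= cos y ^+ m.*2.
Proof.
move=> c0; rewrite -mul2n exprM -mulrN expRM_natl.
apply: lerXn2r; rewrite ?nnegrE ?sqr_ge0 ?expR_ge0//.
have c2 : 0 < cos y ^+ 2 by rewrite lt0r expf_neq0// sqr_ge0.
rewrite expRN -[leRHS]invrK lef_pV2 ?posrE ?expR_gt0 ?invr_gt0//.
by rewrite cos2_tan2//; exact: expR_ge1Dx.
Qed.

(** * Passage to the limit in the finite identity *)

Section polya_limit.
Variables (R : realType) (c : R).
Hypothesis c0 : 0 < c.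

(** The regime of the limit: [q ^+ 2 / m] tends to [c], which is the scale at which
    [cos ^+ (2 m)] on the grid of step [pi / q] and the binomial ratios at the
    multiples of [q] both have Gaussian limits. *)
Let q (p : nat) : R := p.*2.+1%:R.
Let m (p : nat) : nat := Num.truncn (q p ^+ 2 / c).

Let q_gt0 p : 0 < q p. Proof. by rewrite ltr0n. Qed.

Let q_ge p : p%:R <= q p.
Proof. by rewrite ler_nat; lia. Qed.

Lemma cvg_polya_inv : (q p)^-1 @[p --> \oo] --> (0 : R).
Proof.
apply: (@squeeze_cvgr _ _ _ _ (fun=> 0) (@harmonic R)).
- near=> p; rewrite invr_ge0 ltW//= lef_pV2 ?posrE// ler_nat; lia.
- exact: cvg_cst.
- exact: cvg_harmonic.
Unshelve. all: by end_near. Qed.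

Let m_itv p : q p ^+ 2 / c - 1 < (m p)%:R <= q p ^+ 2 / c.
Proof.
have h : 0 <= q p ^+ 2 / c by rewrite divr_ge0 ?sqr_ge0// ltW.
have /andP[h1 h2] := truncn_itv h.
by rewrite /m h1 andbT ltrBlDr natr1.
Qed.

Lemma cvg_polya_ratio : (m p)%:R / q p ^+ 2 @[p --> \oo] --> c^-1.
Proof.
have cl : c^-1 - (q p)^-1 ^+ 2 @[p --> \oo] --> c^-1.
  rewrite -[X in _ --> X]subr0; apply: cvgB; first exact: cvg_cst.
  rewrite -[X in _ --> X](mulr0 0); under eq_fun do rewrite expr2.
  by apply: cvgM; exact: cvg_polya_inv.
apply: (squeeze_cvgr _ cl (cvg_cst c^-1)); near=> p.
have q0 := q_gt0 p; have q20 : 0 < q p ^+ 2 by rewrite exprn_gt0.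
have /andP[h1 h2] := m_itv p.
rewrite ler_pdivrMr// ler_pdivlMr// (mulrC c^-1) h2 andbT.
apply: ltW; apply: le_lt_trans h1.
by rewrite le_eqVlt; apply/orP; left; apply/eqP; field; rewrite !gt_eqF.
Unshelve. all: by end_near. Qed.

Lemma cvg_polya_dim : m p @[p --> \oo] --> \oo.
Proof.
have h : ((m p)%:R : R) @[p --> \oo] --> +oo%R.
  apply/cvgryPge => A; near=> p.
  have /andP[h1 h2] := m_itv p.
  apply: (le_trans _ (ltW h1)); rewrite lerBrDr ler_pdivlMr//.
  apply: (@le_trans _ _ (q p)); last first.
    by rewrite expr2 ler_peMr ?(ltW (q_gt0 p))// /q ler1n.
  apply: le_trans (q_ge p); near: p; exact: nbhs_infty_ger.
by move: h; rewrite cvgrnyP.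
Unshelve. all: by end_near. Qed.

Let ratio_ge : \forall p \near \oo, (2 * c)^-1 <= (m p)%:R / q p ^+ 2.
Proof.
apply: (cvgr_ge _ cvg_polya_ratio).
by rewrite ltf_pV2 ?posrE ?mulr_gt0// ltr_pMl// ltr1n.
Qed.

Let ratio_le : \forall p \near \oo, (m p)%:R / q p ^+ 2 <= 2 / c.
Proof.
apply: (cvgr_le _ cvg_polya_ratio).
by rewrite ltr_pMl ?invr_gt0// ltr1n.
Qed.

Let cvg_geo (d : R) : 0 < d -> cvgn (series (fun j => expR (- (j.+1%:R * d)))).
Proof.
move=> d0.
have -> : (fun j => expR (- (j.+1%:R * d))) = geometric (expR (- d)) (expR (- d)).
  by apply/funext => j /=; rewrite -mulrN expRM_natl exprS.
by apply: is_cvg_geometric_series; rewrite ger0_norm ?expR_ge0// expR_lt1 oppr_lt0.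
Qed.

Lemma cvg_polya_cos_sum :
  \sum_(0 <= j < p) cos (j.+1%:R / q p * pi) ^+ (m p).*2 @[p --> \oo] -->
  limn (series (fun j => expR (- (j.+1%:R ^+ 2 * pi ^+ 2 / c)))).
Proof.
have pi0 := @pi_gt0 R.
have yE (p j : nat) : (j < p)%N -> 0 <= j.+1%:R / q p * pi < pi / 2.
  move=> jp; rewrite mulr_ge0 ?divr_ge0 ?pi_ge0//=.
  rewrite [ltRHS]mulrC ltr_pM2r// ltr_pdivrMr// mulrC ltr_pdivlMr//.
  by rewrite -natrM ltr_nat; lia.
pose d : R := (2 * c)^-1.
have d0 : 0 < d by rewrite invr_gt0 mulr_gt0.
apply: (cvg_sum_tannery (cvg_geo d0)).
- near=> p => j jp; have /andP[y0 y1] := yE _ _ jp.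
  set y := _ * pi in y0 y1 *.
  rewrite ger0_norm; last by rewrite exprn_even_ge0// odd_double.
  apply: (le_trans (cosX2_le _ _)); rewrite ler_expR lerN2.
  (* A Gaussian majorant: [m (y / 2) ^+ 2 >= d (j + 1) ^+ 2 >= d (j + 1)]. *)
  have hs : y / 2 <= sin y by apply: half_le_sin; rewrite y0 ltW.
  have hs2 : (y / 2) ^+ 2 <= sin y ^+ 2.
    by apply: lerXn2r; rewrite ?nnegrE ?(le_trans _ hs) ?divr_ge0.
  apply: (@le_trans _ _ ((m p)%:R * (y / 2) ^+ 2)); last by rewrite ler_wpM2l.
  have -> : (m p)%:R * (y / 2) ^+ 2 = (m p)%:R / q p ^+ 2 * (j.+1%:R ^+ 2 * (pi / 2) ^+ 2).
    by rewrite /y; field; rewrite gt_eqF.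
  rewrite mulrC; apply: ler_pM => //; first exact: ltW.
    by near: p; exact: ratio_ge.
  rewrite expr2 -mulrA ler_peMr// mulr_ege1 ?ler1n// expr_ge1 ?pihalf_ge1//.
  by rewrite divr_ge0 ?pi_ge0.
- exact: cvg_id.
move=> j.
pose y p := j.+1%:R / q p * pi.
have cy : y p @[p --> \oo] --> 0.
  rewrite -[X in _ --> X](mul0r pi) -(mulr0 j.+1%:R).
  by apply: cvgMl; apply: cvgMr; exact: cvg_polya_inv.
have ccos : cos (y p) ^+ 2 @[p --> \oo] --> (1 : R).
  rewrite -[X in _ --> X](expr1n _ 2) -cos0; under eq_fun do rewrite expr2.
  by rewrite expr2; apply: cvgM; apply: continuous_cvg => //; exact: continuous_cos.
pose z p := (m p)%:R * y p ^+ 2.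
have cz : z p @[p --> \oo] --> (j.+1%:R ^+ 2 * pi ^+ 2 / c : R).
  have -> : z = fun p => j.+1%:R ^+ 2 * pi ^+ 2 * ((m p)%:R / q p ^+ 2).
    by apply/funext => p; rewrite /z /y; field; rewrite gt_eqF.
  by apply: cvgMr; exact: cvg_polya_ratio.
(* The exponents [m sin ^+ 2] and [m tan ^+ 2] of the two Gaussian bounds lie
   between [z cos ^+ 2] and [z / cos ^+ 2]. *)
have cl : expR (- (z p / cos (y p) ^+ 2)) @[p --> \oo] -->
    expR (- (j.+1%:R ^+ 2 * pi ^+ 2 / c)).
  apply: continuous_cvg; first exact: continuous_expR.
  apply: cvgN; rewrite -[X in _ --> X]divr1; apply: cvgM => //.
  by apply: cvgV => //; exact: oner_neq0.
have cu : expR (- (z p * cos (y p) ^+ 2)) @[p --> \oo] -->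
    expR (- (j.+1%:R ^+ 2 * pi ^+ 2 / c)).
  apply: continuous_cvg; first exact: continuous_expR.
  by apply: cvgN; rewrite -[X in _ --> X]mulr1; apply: cvgM.
apply: (squeeze_cvgr _ cl cu); near=> p.
have jp : (j < p)%N by near: p; exists j.+1.
have /andP[y0 y1] := yE _ _ jp; rewrite -/(y p) in y0 y1 *.
have c0' : 0 < cos (y p).
  by apply: cos_gt0_pihalf; rewrite y1 andbT (lt_le_trans _ y0)// oppr_lt0 divr_gt0.
have s0 : 0 <= sin (y p).
  by apply: sin_ge0_pi; rewrite y0 ltW// (lt_trans y1)// ltr_pdivrMr// ltr_pMr// ltr1n.
have yc0 : 0 <= y p * cos (y p) := mulr_ge0 y0 (ltW c0').
apply/andP; split.
  apply: le_trans (cosX2_ge _ (lt0r_neq0 c0')); rewrite ler_expR lerN2 /z -mulrA.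
  rewrite ler_wpM2l// /tan expr_div_n ler_wpM2r ?invr_ge0 ?sqr_ge0//.
  by apply: lerXn2r; rewrite ?nnegrE// sin_le_id.
apply: (le_trans (cosX2_le _ _)); rewrite ler_expR lerN2 /z -mulrA -exprMn.
rewrite ler_wpM2l//; apply: lerXn2r; rewrite ?nnegrE//.
apply: mul_cos_le_sin; rewrite y0 ltW// (lt_trans y1)//.
by rewrite ltr_pdivrMr// ltr_pMr// ltr1n.
Unshelve. all: by end_near. Qed.

Lemma cvg_polya_binomial_sum :
  \sum_(0 <= l < m p) binomial_ratio R (m p) (l.+1 * p.*2.+1) @[p --> \oo] -->
  limn (series (fun l => expR (- (l.+1%:R ^+ 2 * c)))).
Proof.
pose d : R := c / 4.
have d0 : 0 < d by rewrite divr_gt0.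
have kE l p : (l.+1 * p.*2.+1)%:R = l.+1%:R * q p by rewrite natrM.
apply: (cvg_sum_tannery (cvg_geo d0)).
- near=> p => l lm; rewrite ger0_norm ?binomial_ratio_ge0//.
  have [km|km] := leqP (l.+1 * p.*2.+1) (m p); last first.
    by rewrite binomial_ratio_small ?expR_ge0.
  apply: (le_trans (binomial_ratio_le _ km)); rewrite ler_expR lerN2 kE.
  have m0 : 0 < (m p)%:R :> R by rewrite ltr0n; lia.
  have km' : l.+1%:R * q p <= (m p)%:R by rewrite -kE ler_nat.
  (* Ratios beyond [m] vanish, so the denominator [m + k] is at most [2 m]. *)
  apply: (@le_trans _ _ ((l.+1%:R * q p) ^+ 2 / (2 * (m p)%:R))); last first.
    rewrite ler_wpM2l ?sqr_ge0// lef_pV2 ?posrE ?mulr_gt0//.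
      by rewrite mulrDl mul1r lerD2l.
    by rewrite ltr_wpDr// mulr_ge0// ltW.
  have -> : (l.+1%:R * q p) ^+ 2 / (2 * (m p)%:R) =
      l.+1%:R ^+ 2 / 2 / ((m p)%:R / q p ^+ 2).
    by field; rewrite !gt_eqF.
  have r : (m p)%:R / q p ^+ 2 <= 2 / c by near: p; exact: ratio_le.
  have r0 : 0 < (m p)%:R / q p ^+ 2 by rewrite divr_gt0// exprn_gt0.
  rewrite ler_pdivlMr//.
  apply: (@le_trans _ _ (l.+1%:R * d * (2 / c))).
    by rewrite ler_wpM2l// mulr_ge0// ltW.
  have -> : l.+1%:R * d * (2 / c) = l.+1%:R / 2 by rewrite /d; field; rewrite gt_eqF.
  by rewrite ler_pM2r// expr2 ler_peMr// ler1n.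
- exact: cvg_polya_dim.
move=> l; pose a : R := l.+1%:R.
(* Divided by [q ^+ 2], the denominators [m + k] and [m - k + 1] of the two bounds
   have the same limit [c^-1]. *)
pose r p := (m p)%:R / q p ^+ 2.
have ci : (q p)^-1 @[p --> \oo] --> (0 : R) by exact: cvg_polya_inv.
have cai : a * (q p)^-1 @[p --> \oo] --> (0 : R).
  by rewrite -(mulr0 a); apply: cvgMr.
have ci2 : (q p)^-1 * (q p)^-1 @[p --> \oo] --> (0 : R).
  by rewrite -(mulr0 0); apply: cvgM.
have main (s : nat -> R) : s p @[p --> \oo] --> c^-1 ->
    expR (- (a ^+ 2 / s p)) @[p --> \oo] --> expR (- (a ^+ 2 * c)).
  move=> cs; apply: continuous_cvg; first exact: continuous_expR.
  apply: cvgN; apply: cvgMr; rewrite -[X in _ --> X]invrK.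
  by apply: cvgV => //; rewrite invr_eq0 gt_eqF.
have cu := main (fun p => r p + a * (q p)^-1).
have cl := main (fun p => r p - a * (q p)^-1 + (q p)^-1 * (q p)^-1).
apply: (squeeze_cvgr _ (cl _) (cu _)); last first.
- by rewrite -[X in _ --> X]addr0; apply: cvgD => //; exact: cvg_polya_ratio.
- rewrite -[X in _ --> X]addr0; apply: cvgD => //.
  by rewrite -[X in _ --> X]subr0; apply: cvgB => //; exact: cvg_polya_ratio.
have ev : \forall p \near \oo, a * (q p)^-1 <= r p.
  have c10 : 0 < c^-1 by rewrite invr_gt0.
  have h : r p - a * (q p)^-1 @[p --> \oo] --> c^-1.
    by rewrite -[X in _ --> X]subr0; apply: cvgB => //; exact: cvg_polya_ratio.
  by near=> p; rewrite -subr_ge0; near: p; exact: (cvgr_ge _ h).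
near=> p; have h : a * (q p)^-1 <= r p by near: p; exact: ev.
have q0 := q_gt0 p; have q20 : 0 < q p ^+ 2 by rewrite exprn_gt0.
have km' : a * q p <= (m p)%:R.
  move: h; rewrite /r ler_pdivlMr// => h; apply: le_trans h.
  by rewrite le_eqVlt; apply/orP; left; apply/eqP; field; rewrite gt_eqF.
have km : (l.+1 * p.*2.+1 <= m p)%N by rewrite -(ler_nat R) kE.
have a0 : 0 < a by rewrite ltr0n.
have aq0 : 0 < a * q p by rewrite mulr_gt0.
apply/andP; split.
  have := binomial_ratio_ge R km; rewrite kE -/a; congr (_ <= _).
  congr expR; congr (- _); rewrite /r; field.
  by rewrite !gt_eqF//= ?andbT; lra.
have := binomial_ratio_le R km; rewrite kE -/a; congr (_ <= _).
congr expR; congr (- _); rewrite /r; field.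
by rewrite !gt_eqF//= ?andbT; lra.
Unshelve. all: by end_near. Qed.

End polya_limit.

(** * Inversion and differentiation of the theta function *)

Definition gauss_term (R : realType) (j : nat) (x : R) (k : nat) : R :=
  k.+1%:R ^+ 2 ^+ j * expR (- pi * k.+1%:R ^+ 2 * x).

(** The [j]-th derivative of half of [theta - 1], up to the factor
    [(- pi) ^+ j]. *)
Definition gauss_series (R : realType) (j : nat) (x : R) : R :=
  limn (series (gauss_term j x)).

(** A telescoping majorant of [1 / (k + 1) ^+ 2]: twice [1 / (k + 1) - 1 / (k + 2)]. *)
Definition oblong_inv (R : realType) (k : nat) : R :=
  2 / (k.+1%:R * k.+2%:R).

Lemma cvg_oblong_inv (R : realType) : series (@oblong_inv R) @ \oo --> (2 : R).
Proof.
have -> : series (@oblong_inv R) = (fun n => 2 * (1 - (n.+1%:R)^-1)).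
  apply/funext; elim=> [|n IH]; first by rewrite /series /= big_geq// invr1 subrr mulr0.
  rewrite seriesSr /= {}[X in X + _]IH /oblong_inv.
  rewrite -(natr1 n.+1); field.
  by rewrite nat1r natr1 !pnatr_eq0.
rewrite -[X in _ --> X]mulr1; apply: cvgMr.
rewrite -[X in _ --> X]subr0; apply: cvgB; first exact: cvg_cst.
exact: cvg_harmonic.
Qed.

Lemma inv_sqr_le_oblong (R : realType) k :
  (k.+1%:R ^+ 2)^-1 <= oblong_inv R k.
Proof.
have k1 : 1 <= k.+1%:R :> R by rewrite ler1n.
rewrite /oblong_inv ler_pdivlMr ?mulr_gt0// mulrC ler_pdivrMr ?exprn_gt0//.
by rewrite -(natr1 k.+1); nra.
Qed.

Lemma gauss_term_ge0 (R : realType) j (x : R) k : 0 <= gauss_term j x k.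
Proof. by rewrite mulr_ge0 ?exprn_ge0 ?expR_ge0. Qed.

Lemma expRN_le (R : realType) n (y : R) : 0 < y ->
  expR (- y) <= n`!%:R / y ^+ n.
Proof.
move=> y0; rewrite expRN -[leRHS]invf_div lef_pV2 ?posrE ?expR_gt0//; last first.
  by rewrite divr_gt0 ?exprn_gt0// ltr0n fact_gt0.
case: n => [|n]; first by rewrite expr0 divr1 ltW// expR_gt1.
by apply: le_trans (expR_ge1Dxn n (ltW y0)); rewrite lerDr.
Qed.

(** From [expRN_le] with [n] above [j]; small [n] gives the summability, larger [n]
    the decay in [x]. *)
Lemma gauss_term_le (R : realType) j n (x : R) k : 0 < x -> (j < n)%N ->
  gauss_term j x k <= n`!%:R / x ^+ n * oblong_inv R k.
Proof.
move=> x0 jn; set y : R := k.+1%:R ^+ 2.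
have pi1 : 1 <= pi :> R by apply: le_trans (pi_ge2 R); rewrite ler1n.
have y1 : 1 <= y by rewrite expr_ge1// ler1n.
have y0 : 0 < y by apply: lt_le_trans y1.
have yx0 : 0 < y * x by rewrite mulr_gt0.
rewrite /gauss_term -/y.
have h1 : expR (- pi * y * x) <= n`!%:R / (y * x) ^+ n.
  apply: le_trans (expRN_le n yx0); rewrite ler_expR -mulrA mulNr lerN2.
  by rewrite ler_peMl// ltW.
apply: (le_trans (ler_wpM2l (exprn_ge0 j (ltW y0)) h1)).
have -> : y ^+ j * (n`!%:R / (y * x) ^+ n) = n`!%:R / x ^+ n * (y ^+ j / y ^+ n).
  by rewrite (exprMn n y x); field; rewrite !expf_neq0// gt_eqF.
rewrite ler_wpM2l ?divr_ge0 ?exprn_ge0 ?(ltW x0)//.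
apply: (@le_trans _ _ y^-1).
  rewrite ler_pdivrMr ?exprn_gt0// mulrC ler_pdivlMr// -exprSr.
  exact: ler_weXn2l.
exact: inv_sqr_le_oblong.
Qed.

Lemma is_cvg_gauss_series (R : realType) j (x : R) : 0 < x ->
  cvgn (series (gauss_term j x)).
Proof.
move=> x0; apply: (@is_cvg_series_dominated _ _
    (fun k => j.+1`!%:R / x ^+ j.+1 * oblong_inv R k)) => [|k].
  have := @is_cvg_seriesZ _ _ (j.+1`!%:R / x ^+ j.+1)
    (cvgP _ (@cvg_oblong_inv R)).
  by [].
by rewrite ger0_norm ?gauss_term_ge0// gauss_term_le.
Qed.

Lemma gauss_series_ge0 (R : realType) j (x : R) : 0 < x -> 0 <= gauss_series j x.
Proof.
move=> x0; apply: limr_ge; first exact: is_cvg_gauss_series.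
by near=> n; apply: sumr_ge0 => k _; exact: gauss_term_ge0.
Unshelve. all: by end_near. Qed.

Lemma gauss_series_le (R : realType) j n (x : R) : 0 < x -> (j < n)%N ->
  gauss_series j x <= 2 * n`!%:R / x ^+ n.
Proof.
move=> x0 jn; have h : n`!%:R / x ^+ n * series (@oblong_inv R) N @[N --> \oo] -->
    n`!%:R / x ^+ n * 2 by apply: cvgMr; exact: cvg_oblong_inv.
apply: (@le_trans _ _ (n`!%:R / x ^+ n * 2)); last by rewrite mulrC mulrA.
have d : series (gauss_term j x) N @[N --> \oo] --> gauss_series j x.
  exact: is_cvg_gauss_series.
apply: (ler_cvg_to d h).
near=> N; rewrite /series /= big_distrr /=.
by apply: ler_sum => k _; exact: gauss_term_le.
Unshelve. all: by end_near. Qed.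

(** The theta function [sum_(n in Z) expR (- pi n^2 x)]. *)
Definition theta (R : realType) (x : R) : R := 1 + 2 * gauss_series 0 x.

Lemma theta_gt0 (R : realType) (x : R) : 0 < x -> 0 < theta x.
Proof. by move=> x0; rewrite ltr_pwDl// mulr_ge0// gauss_series_ge0. Qed.

(** The limit of [polya_identity].  Squared, its factor [q C(2m, m) / 4^m] is the
    convergent sequence of [is_cvg_central_binomial] divided by [m / q ^+ 2], whose
    limit is known. *)
Lemma theta_inv_sqr (R : realType) (x : R) : 0 < x ->
  theta x^-1 ^+ 2 =
  limn (fun m => central_binomial R m ^+ 2 * m%:R) * (pi * x) * theta x ^+ 2.
Proof.
move=> x0; set K : R := limn _.
have c0 : 0 < pi * x by rewrite mulr_gt0 ?pi_gt0.
have cA := cvg_polya_cos_sum c0; have cB := cvg_polya_binomial_sum c0.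
have cm := cvg_polya_dim c0; have cr := cvg_polya_ratio c0.
set m := fun p => Num.truncn _ in cA cB cm cr.
have eA : (fun j => expR (- (j.+1%:R ^+ 2 * pi ^+ 2 / (pi * x)))) =
    gauss_term 0 x^-1.
  apply/funext => j; rewrite /gauss_term expr0 mul1r; congr expR.
  move: (@pi R) (@pi_gt0 R) => P P0; field.
  by rewrite (gt_eqF x0) (gt_eqF P0).
have eB : (fun l => expR (- (l.+1%:R ^+ 2 * (pi * x)))) = gauss_term 0 x.
  by apply/funext => j; rewrite /gauss_term expr0 mul1r; congr expR; ring.
rewrite {}eA in cA; rewrite {}eB in cB.
set A := fun p => _ in cA; set B := fun p => _ in cB.
have sqr_cvg (u : nat -> R) (l : R) : u @ \oo --> l ->
    (1 + 2 * u p) ^+ 2 @[p --> \oo] --> (1 + 2 * l) ^+ 2.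
  move=> ul; under eq_fun do rewrite expr2; rewrite expr2.
  by apply: cvgM; (apply: cvgD; [exact: cvg_cst|apply: cvgMr; exact: ul]).
have cK : central_binomial R (m p) ^+ 2 * (m p)%:R @[p --> \oo] --> K.
  exact: (cvg_comp _ _ cm (@is_cvg_central_binomial R)).
have c1 : (1 + 2 * A p) ^+ 2 @[p --> \oo] --> theta x^-1 ^+ 2.
  exact: (sqr_cvg _ _ cA).
have c2 : central_binomial R (m p) ^+ 2 * (m p)%:R /
    ((m p)%:R / p.*2.+1%:R ^+ 2) * (1 + 2 * B p) ^+ 2 @[p --> \oo] -->
    K * (pi * x) * theta x ^+ 2.
  apply: cvgM; last exact: sqr_cvg.
  apply: cvgM => //; rewrite -[X in _ --> X]invrK.
  by apply: cvgV => //; rewrite invr_eq0 gt_eqF.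
have m_gt0 : \forall p \near \oo, (0 < m p)%N.
  by apply: (cm [set n | (0 < n)%N]); exists 1%N.
rewrite -(cvg_lim _ c1)//; apply: cvg_lim => //; apply: cvg_trans c2; apply: near_eq_cvg; near=> p.
have m0 : (0 < m p)%N by near: p.
rewrite /A polya_identity -/(B p) !exprMn; field.
by rewrite expf_neq0// nat1r !pnatr_eq0/= -lt0n m0.
Unshelve. all: by end_near. Qed.

(** Jacobi's inversion formula: [theta_inv_sqr] at [x = 1] evaluates its constant,
    and positivity removes the squares. *)
Lemma theta_inv (R : realType) (x : R) : 0 < x ->
  theta x^-1 = Num.sqrt x * theta x.
Proof.
move=> x0; have := @theta_inv_sqr R 1 ltr01.
rewrite invr1 -[X in X = _]mul1r mulr1 => /mulIf.
rewrite expf_neq0 ?gt_eqF ?theta_gt0// => /(_ isT) e.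
have := theta_inv_sqr x0; rewrite mulrA -e mul1r => h.
have s0 : 0 <= Num.sqrt x * theta x by rewrite mulr_ge0 ?sqrtr_ge0 ?ltW ?theta_gt0.
apply/eqP; rewrite -(@eqrXn2 _ 2)//; last by rewrite ltW// theta_gt0// invr_gt0.
by rewrite h exprMn sqr_sqrtr// ltW.
Qed.

(** Apply [1 + v <= expR v] at [v = u] and at [v = - u]. *)
Lemma expR_sub1Dx_le (R : realType) (u : R) :
  `|expR u - 1 - u| <= u ^+ 2 * expR `|u|.
Proof.
have h1 := expR_ge1Dx u; have h2 := expR_ge1Dx (- u).
have e0 := expR_gt0 u.
have h3 : expR u - 1 <= u * expR u.
  have : (1 - u) * expR u <= 1 by rewrite -[leRHS](expRxMexpNx_1 u) mulrC ler_pM2l.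
  by rewrite mulrBl mul1r; lra.
rewrite ger0_norm; last lra.
have [u0|u0] := leP 0 u; first by rewrite ger0_norm//; nra.
have a1 : 1 <= expR `|u| by rewrite -expR0 ler_expR.
have : expR u <= 1 by rewrite -[leRHS]expR0 ler_expR ltW.
by nra.
Qed.

(** Termwise differentiation: for [`|h| < x / 2] the second-order remainder of the
    [k]-th term is at most [pi ^+ 2 h ^+ 2] times the [k]-th term, at [x / 2], of
    the series two orders higher. *)
Lemma is_derive_gauss_series (R : realType) j (x : R) : 0 < x ->
  is_derive x 1 (gauss_series j) (- pi * gauss_series j.+1 x).
Proof.
move=> x0; set s := - pi * _; set f := gauss_series j.
have x20 : 0 < x / 2 by rewrite divr_gt0.
pose g (h : R) k := h^-1 * (gauss_term j (h + x) k - gauss_term j x k)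
  + pi * gauss_term j.+1 x k.
have cg := @is_cvg_seriesZ _ _ (pi ^+ 2) (@is_cvg_gauss_series R j.+2 _ x20).
have H : limn (series (g h)) @[h --> 0^'] --> 0.
  apply: (lim_cvg_to_0_linear x20 cg) => h /andP[h0 hx] k.
  have hn0 : h != 0 by rewrite -normr_gt0.
  pose l : R := pi * k.+1%:R ^+ 2; pose u := - (l * h).
  have l0 : 0 <= l by rewrite mulr_ge0 ?pi_ge0 ?sqr_ge0.
  pose a : R := k.+1%:R ^+ 2 ^+ j * expR (- (l * x)).
  have a0 : 0 <= a by rewrite mulr_ge0 ?expR_ge0 ?exprn_ge0.
  have -> : g h k = h^-1 * (a * (expR u - 1 - u)).
    rewrite /g /gauss_term [_ ^+ j.+1]exprS.
    have -> : expR (- pi * k.+1%:R ^+ 2 * (h + x)) = expR u * expR (- (l * x)).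
      by rewrite -expRD /u /l; congr expR; ring.
    have -> : - pi * k.+1%:R ^+ 2 * x = - (l * x) by rewrite /l; ring.
    by rewrite /a /u /l; field.
  have -> : (pi ^+ 2 *: gauss_term j.+2 (x / 2)) k = pi ^+ 2 * gauss_term j.+2 (x / 2) k by [].
  rewrite normrM normfV normrM (ger0_norm a0).
  rewrite ler_pdivrMl//.
  apply: (le_trans (ler_wpM2l a0 (expR_sub1Dx_le u))).
  have -> : `|h| * (pi ^+ 2 * gauss_term j.+2 (x / 2) k * `|h|) =
     k.+1%:R ^+ 2 ^+ j * u ^+ 2 * expR (- (l * (x / 2))).
    rewrite /gauss_term [_ ^+ j.+2]exprS [_ ^+ j.+1]exprS.
    have -> : u ^+ 2 = l ^+ 2 * `|h| ^+ 2.
      by rewrite /u sqrrN (exprMn 2 l h) (real_normK (num_real h)).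
    have -> : - pi * k.+1%:R ^+ 2 * (x / 2) = - (l * (x / 2)) by rewrite /l; ring.
    by rewrite [in X in _ = _ * X * _]/l; ring.
  have -> : a * (u ^+ 2 * expR `|u|) =
     k.+1%:R ^+ 2 ^+ j * u ^+ 2 * expR (- (l * x) + `|u|).
    by rewrite /a expRD; ring.
  rewrite (ler_wpM2l (mulr_ge0 (exprn_ge0 j (sqr_ge0 _)) (sqr_ge0 u)))//.
  rewrite ler_expR /u normrN normrM (ger0_norm l0) addrC -mulrBr -mulrN.
  by rewrite ler_wpM2l//; lra.
have Q : h^-1 *: (f (h + x) - f x) @[h --> 0^'] --> s.
  apply: cvg_zero; apply: cvg_trans H; apply: near_eq_cvg; near=> h.
  have hx : 0 < h + x.
    have : `|h| < x.
      near: h; apply: dnbhs0_lt; exact: x0.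
    by rewrite ltr_norml => /andP[+ _]; rewrite -ltrBlDr sub0r.
  have d1 := @is_cvg_gauss_series R j _ hx; have d2 := @is_cvg_gauss_series R j _ x0.
  have d3 := @is_cvg_gauss_series R j.+1 _ x0.
  have -> : series (g h) = (fun n => h^-1 * (series (gauss_term j (h + x)) n -
      series (gauss_term j x) n) + pi * series (gauss_term j.+1 x) n).
    have -> : g h = h^-1 *: (gauss_term j (h + x) - gauss_term j x) +
        (pi : R) *: gauss_term j.+1 x by [].
    by rewrite seriesD !seriesZ seriesD seriesN.
  have L : h^-1 * (series (gauss_term j (h + x)) n -
      series (gauss_term j x) n) + pi * series (gauss_term j.+1 x) n
      @[n --> \oo] --> h^-1 * (f (h + x) - f x) + pi * gauss_series j.+1 x.
    apply: cvgD; last by apply: cvgMr; exact: d3.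
    by apply: cvgMr; apply: cvgB; [exact: d1|exact: d2].
  by rewrite (cvg_lim _ L)// /s mulNr opprK.
constructor; last by rewrite -derive1E; apply: cvg_lim Q.
move: Q; rewrite /derivable [X in X @ 0^'](_ : _ =
    (fun h => h^-1 *: (f (h%:A + x) - f x))) /=; last first.
  by apply/funext => i //=; rewrite [i%:A]mulr1.
by move=> Q; apply/cvg_ex; exists s.
Unshelve. all: by end_near. Qed.

(** * Inversion and decay of omega *)

Lemma omegaE (R : realType) (x : R) : 0 < x ->
  omega x = 2 * pi ^+ 2 * x ^+ 2 * gauss_series 2 x - 3 * pi * x * gauss_series 1 x.
Proof.
move=> x0; rewrite /omega.
have -> : series (fun k : nat =>
    (2 * pi ^+ 2 * k.+1%:R ^+ 4 * x ^+ 2 - 3 * pi * k.+1%:R ^+ 2 * x)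
    * expR (- pi * k.+1%:R ^+ 2 * x)) =
  (fun n => 2 * pi ^+ 2 * x ^+ 2 * series (gauss_term 2 x) n -
            3 * pi * x * series (gauss_term 1 x) n).
  apply/funext => n; rewrite /series /= !big_distrr /= -sumrB.
  by apply: eq_bigr => k _; rewrite /gauss_term; ring.
apply: cvg_lim => //.
by apply: cvgB; apply: cvgMr; exact: is_cvg_gauss_series.
Qed.

Lemma is_derive_theta (R : realType) (x : R) : 0 < x ->
  is_derive x 1 (@theta R) (- (2 * pi) * gauss_series 1 x).
Proof.
move=> x0; have d := is_derive_gauss_series 0 x0.
have d1 := is_deriveD (is_derive_cst (1 : R) x 1) (is_deriveZ 2 d).
have e : cst 1 + (2 : R) *: @gauss_series R 0 = @theta R by apply/funext.
rewrite e add0r in d1.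
have -> : - (2 * pi) * gauss_series 1 x = 2 *: (- pi * gauss_series 1 x).
  by rewrite /GRing.scale /=; ring.
exact: d1.
Qed.

Lemma is_derive_expn (R : realType) n (y : R) :
  is_derive y 1 (fun z : R => z ^+ n) (n%:R * y ^+ n.-1).
Proof.
apply: DeriveDef; first exact: exprn_derivable.
by rewrite exp_derive /GRing.scale /= mulr1.
Qed.

Lemma is_derive_expVn (R : realType) n (y : R) : y != 0 ->
  is_derive y 1 (fun z : R => z ^- n) (- n%:R * y ^- n.+1).
Proof.
move=> y0; have yn0 : y ^+ n != 0 by rewrite expf_neq0.
have d := is_deriveV (f := fun z : R => z ^+ n) yn0 (is_derive_expn n y).
apply: is_derive_eq; rewrite /GRing.scale /=; case: n {yn0 d} => [|n] /=.
  by rewrite !(mul0r, mulr0, oppr0).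
by rewrite !exprS; field; rewrite y0 expf_neq0.
Qed.

(** The derivative of the inversion formula in the variable [y = sqrt x], in which
    it reads [theta (y ^- 2) = y * theta (y ^+ 2)]. *)
Lemma gauss_series1_inv (R : realType) (y : R) : 0 < y ->
  4 * pi * y ^- 3 * gauss_series 1 (y ^- 2) =
  theta (y ^+ 2) - 4 * pi * y ^+ 2 * gauss_series 1 (y ^+ 2).
Proof.
move=> y0; have yn0 : y != 0 by rewrite gt_eqF.
have y20 : 0 < y ^+ 2 by rewrite exprn_gt0.
have dl : is_derive y 1 (@theta R \o fun z : R => z ^- 2)
    (4 * pi * y ^- 3 * gauss_series 1 (y ^- 2)).
  have yi20 : 0 < y ^- 2 by rewrite invr_gt0.
  have d := is_derive1_comp (g := fun z : R => z ^- 2) (is_derive_theta yi20) (is_derive_expVn 2 yn0).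
  by apply: is_derive_eq; ring.
have dr : is_derive y 1 (id * (@theta R \o fun z : R => z ^+ 2))
    (theta (y ^+ 2) - 4 * pi * y ^+ 2 * gauss_series 1 (y ^+ 2)).
  have d := is_derive1_comp (g := fun z : R => z ^+ 2) (is_derive_theta y20) (is_derive_expn 2 y).
  by apply: is_derive_eq; rewrite /GRing.scale /=; ring.
have e : \near y, (@theta R \o fun z : R => z ^- 2) y =
                  (id * (@theta R \o fun z : R => z ^+ 2)) y.
  near=> z; have z0 : 0 < z by near: z; exact: lt_nbhsr.
  by rewrite /= theta_inv ?exprn_gt0// sqrtr_sqr gtr0_norm.
by have [_ <-] := near_eq_is_derive e dl; have [_ <-] := dr.
Unshelve. all: by end_near. Qed.

(** Differentiating once more gives the inversion formula of
    [omega = x^2 theta'' + (3/2) x theta']. *)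
Lemma omega_sqr_inv (R : realType) (y : R) : 0 < y ->
  omega (y ^- 2) = y * omega (y ^+ 2).
Proof.
move=> y0; have yn0 : y != 0 by rewrite gt_eqF.
have y20 : 0 < y ^+ 2 by rewrite exprn_gt0.
have yi20 : 0 < y ^- 2 by rewrite invr_gt0.
pose G1 : R -> R := @gauss_series R 1.
pose dG1 x := - pi * @gauss_series R 2 x.
have dGi : is_derive y 1 (G1 \o fun z : R => z ^- 2)
    (2 * pi * y ^- 3 * gauss_series 2 (y ^- 2)).
  have d := is_derive1_comp (g := fun z : R => z ^- 2) (is_derive_gauss_series 1 yi20) (is_derive_expVn 2 yn0).
  by apply: is_derive_eq; ring.
have dG : is_derive y 1 (G1 \o fun z : R => z ^+ 2)
    (- 2 * pi * y * gauss_series 2 (y ^+ 2)).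
  have d := is_derive1_comp (g := fun z : R => z ^+ 2) (is_derive_gauss_series 1 y20) (is_derive_expn 2 y).
  by apply: is_derive_eq; ring.
have dl : is_derive y 1 (4 * pi *: ((fun z : R => z ^- 3) * (G1 \o fun z : R => z ^- 2)))
    (4 * pi * (y ^- 3 * (2 * pi * y ^- 3 * gauss_series 2 (y ^- 2)) +
      G1 (y ^- 2) * (- 3 * y ^- 4))).
  have d := is_derive_expVn 3 yn0.
  by apply: is_derive_eq; rewrite /GRing.scale.
have dr : is_derive y 1 ((@theta R \o fun z : R => z ^+ 2) -
      4 * pi *: ((fun z : R => z ^+ 2) * (G1 \o fun z : R => z ^+ 2)))
    (- (2 * pi) * G1 (y ^+ 2) * (2 * y) -
     4 * pi * (y ^+ 2 * (- 2 * pi * y * gauss_series 2 (y ^+ 2)) +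
        G1 (y ^+ 2) * (2 * y))).
  have d := is_derive1_comp (g := fun z : R => z ^+ 2) (is_derive_theta y20) (is_derive_expn 2 y).
  have d2 := is_derive_expn 2 y.
  by apply: is_derive_eq; rewrite /GRing.scale.
have e : \near y, (4 * pi *: ((fun z : R => z ^- 3) * (G1 \o fun z : R => z ^- 2))) y =
   ((@theta R \o fun z : R => z ^+ 2) -
      4 * pi *: ((fun z : R => z ^+ 2) * (G1 \o fun z : R => z ^+ 2))) y.
  near=> z; have z0 : 0 < z by near: z; exact: lt_nbhsr.
  have := gauss_series1_inv z0; rewrite -!mulrA => h.
  by rewrite !fctE /= /GRing.scale /= -!mulrA.
have eq : 4 * pi * (y ^- 3 * (2 * pi * y ^- 3 * gauss_series 2 (y ^- 2)) +
      G1 (y ^- 2) * (- 3 * y ^- 4)) =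
    - (2 * pi) * G1 (y ^+ 2) * (2 * y) -
     4 * pi * (y ^+ 2 * (- 2 * pi * y * gauss_series 2 (y ^+ 2)) +
        G1 (y ^+ 2) * (2 * y)).
  by have [_ <-] := near_eq_is_derive e dl; have [_ <-] := dr.
rewrite !omegaE// -/G1.
have /(congr1 ( *%R (y ^+ 2 / 4))) := eq.
have -> : y ^+ 2 / 4 * (4 * pi * (y ^- 3 * (2 * pi * y ^- 3 * gauss_series 2 (y ^- 2)) +
      G1 (y ^- 2) * (- 3 * y ^- 4))) =
   2 * pi ^+ 2 * y ^- 2 ^+ 2 * gauss_series 2 (y ^- 2) - 3 * pi * y ^- 2 * G1 (y ^- 2).
  by move: (@pi R) (gauss_series 2 _) (G1 _) => P a b; field.
by move=> ->; move: (@pi R) (gauss_series 2 _) (G1 _) => P a b; field.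
Unshelve. all: by end_near. Qed.

Lemma omega_inv (R : realType) (x : R) : 0 < x ->
  omega x^-1 = Num.sqrt x * omega x.
Proof.
move=> x0; have s0 : 0 < Num.sqrt x by rewrite sqrtr_gt0.
by have := omega_sqr_inv s0; rewrite sqr_sqrtr// ltW.
Qed.

Lemma continuous_omega (R : realType) (x : R) : 0 < x -> {for x, continuous (@omega R)}.
Proof.
move=> x0.
have cG j : {for x, continuous (@gauss_series R j)}.
  have [d _] := is_derive_gauss_series j x0.
  exact/differentiable_continuous/derivable1_diffP.
have c : {for x, continuous (fun x : R => 2 * pi ^+ 2 * x ^+ 2 * gauss_series 2 x -
    3 * pi * x * gauss_series 1 x)}.
  apply: cvgB; apply: cvgM; try exact: cG.
    by apply: cvgMr; exact: exprn_continuous.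
  by apply: cvgMr; exact: cvg_id.
rewrite /prop_for /continuous_at omegaE//; apply: cvg_trans c.
apply: near_eq_cvg; near=> z; rewrite omegaE//.
by near: z; exact: lt_nbhsr.
Unshelve. all: by end_near. Qed.

Lemma omega_le_invsqr (R : realType) : exists2 C : R, 0 <= C &
  forall x, 0 < x -> `|omega x| <= C / x ^+ 2.
Proof.
have pi0 := @pi_ge0 R.
pose C : R := 2 * pi ^+ 2 * (2 * 4`!%:R) + 3 * pi * (2 * 3`!%:R).
exists C; first by rewrite /C addr_ge0 ?mulr_ge0 ?sqr_ge0.
move=> x x0; have xn0 : x != 0 by rewrite gt_eqF.
rewrite omegaE//.
have h2 := gauss_series_le x0 (isT : (2 < 4)%N).
have h1 := gauss_series_le x0 (isT : (1 < 3)%N).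
have g2 := gauss_series_ge0 2 x0; have g1 := gauss_series_ge0 1 x0.
apply: (le_trans (ler_normB _ _)).
have a2 : 0 <= 2 * pi ^+ 2 * x ^+ 2 by rewrite mulr_ge0 ?sqr_ge0// mulr_ge0 ?sqr_ge0.
have a1 : 0 <= 3 * pi * x by rewrite mulr_ge0 ?(ltW x0)// mulr_ge0.
rewrite (ger0_norm (mulr_ge0 a2 g2)) (ger0_norm (mulr_ge0 a1 g1)).
apply: (le_trans (lerD (ler_wpM2l a2 h2) (ler_wpM2l a1 h1))).
rewrite le_eqVlt; apply/orP; left; apply/eqP.
by rewrite /C; move: (@pi R) (4`!%:R) (3`!%:R) => P a b; field.
Qed.

Lemma powR32 (R : realType) (x : R) : 0 < x -> x `^ (3 / 2) = x * Num.sqrt x.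
Proof.
move=> x0; have -> : 3 / 2 = 1 + 2^-1 :> R by field.
rewrite powRD; last by rewrite gt_eqF ?implybT//.
by rewrite powRr1 ?ltW// powR12_sqrt// ltW.
Qed.

(** With [s = (x - 1) / (x + 1)], the factor [1 - |s|] vanishes at [0] and at
    infinity only.  At infinity [omega] decays faster than any power; at [0] so
    does it, by the inversion formula. *)
Lemma omega_weight_le (R : realType) : exists C : R, forall x : R, 0 < x ->
  `|omega x / (x + 1) `^ (3 / 2)| / (1 - `|(x - 1) / (x + 1)|) `^ (3 / 2)
    <= C * (oneDsqr x)^-1.
Proof.
have [C C0 hC] := omega_le_invsqr R.
exists (2 * C) => x x0.
have x10 : 0 < x + 1 by rewrite ltr_wpDr// ltW.
have o0 : 0 < oneDsqr x by rewrite /oneDsqr ltr_pwDl// sqr_ge0.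
have x2 : 0 < x ^+ 2 by rewrite exprn_gt0.
rewrite normrM normfV (ger0_norm (powR_ge0 _ _)) ler_pdivlMr//.
(* As [(x + 1) (1 - |s|) = 2 v] with [v] the minimum of [1] and [x], the two powers
   multiply to [(2 * v) `^ (3 / 2)]. *)
have mono (v : R) : 0 < v -> v `^ (3 / 2) <= (2 * v) `^ (3 / 2).
  by move=> v0; apply: ge0_ler_powR; rewrite ?nnegrE ?divr_ge0//; lra.
have fold (v : R) : 0 < v -> 1 - `|(x - 1) / (x + 1)| = 2 * v / (x + 1) ->
    `|omega x| * oneDsqr x <= 2 * C * v `^ (3 / 2) ->
  `|omega x| / (x + 1) `^ (3 / 2) / (1 - `|(x - 1) / (x + 1)|) `^ (3 / 2) * oneDsqr x
    <= 2 * C.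
  move=> v0 -> h.
  have v20 : 0 < 2 * v by rewrite mulr_gt0.
  rewrite powRM ?invr_ge0 ?(ltW v20) ?(ltW x10)//.
  have -> : (x + 1)^-1 `^ (3 / 2) = ((x + 1) `^ (3 / 2))^-1.
    by rewrite -powR_inv1 ?(ltW x10)// -powRrM mulN1r powRN.
  have p1 := powR_gt0 (3 / 2) x10; have p2 := powR_gt0 (3 / 2) v20.
  have -> : `|omega x| / (x + 1) `^ (3 / 2) /
      ((2 * v) `^ (3 / 2) / (x + 1) `^ (3 / 2)) * oneDsqr x =
      `|omega x| * oneDsqr x / (2 * v) `^ (3 / 2).
    by field; rewrite !gt_eqF.
  rewrite ler_pdivrMr//; apply: (le_trans h).
  by rewrite ler_wpM2l ?mulr_ge0// mono.
have [x1|x1] := leP 1 x.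
  apply: (fold 1) => //.
    rewrite ger0_norm; last by rewrite divr_ge0 ?subr_ge0// ltW.
    by field; rewrite gt_eqF.
  rewrite powR1 mulr1; apply: (le_trans (ler_wpM2r (ltW o0) (hC _ x0))).
  rewrite mulrAC ler_pdivrMr// -mulrA mulrCA ler_wpM2l// /oneDsqr.
  by nra.
apply: (fold x) => //.
  rewrite ler0_norm; last by rewrite pmulr_lle0 ?invr_gt0// subr_le0 ltW.
  by field; rewrite gt_eqF.
have sx0 : 0 < Num.sqrt x by rewrite sqrtr_gt0.
have : `|omega x| * Num.sqrt x <= C * x ^+ 2.
  have xi0 : 0 < x^-1 by rewrite invr_gt0.
  have := hC _ xi0.
  by rewrite omega_inv// normrM (gtr0_norm sx0) mulrC exprVn invrK.
move=> h; rewrite powR32//.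
have o2 : oneDsqr x <= 2 by rewrite /oneDsqr; nra.
rewrite -(ler_pM2r sx0) mulrAC.
apply: (le_trans (ler_pM _ (ltW o0) h o2)); first by rewrite mulr_ge0 ?(ltW sx0).
have sq : Num.sqrt x * Num.sqrt x = x by rewrite -expr2 sqr_sqrtr// ltW.
have -> : 2 * C * (x * Num.sqrt x) * Num.sqrt x = 2 * C * (x * (Num.sqrt x * Num.sqrt x)) by ring.
by rewrite sq le_eqVlt; apply/orP; left; apply/eqP; ring.
Qed.

(** * The binomial series *)

(** With [`|z| < K < 1] and [K = expR (- d)], the bound [expRN_le] on [K ^+ k] beats
    the polynomial growth by a factor [k ^- 2]. *)
Lemma is_cvg_pseries_poly (R : realType) (c : nat -> R) (C : R) p (z : R) :
  (forall k, `|c k| <= C * k.+1%:R ^+ p) -> `|z| < 1 -> cvgn (pseries c z).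
Proof.
move=> cC z1; pose K := (1 + `|z|) / 2.
have z0 : 0 <= `|z| by [].
have K0 : 0 < K by rewrite /K; lra.
have K1 : K < 1 by rewrite /K; lra.
have zK : `|z| <= K by rewrite /K; lra.
have C0 : 0 <= C.
  by have := le_trans (normr_ge0 _) (cC 0%N); rewrite expr1n mulr1.
pose d := - ln K; have d0 : 0 < d by rewrite oppr_gt0 ln_lt0// K0.
pose B := C / K * p.+2`!%:R / d ^+ p.+2.
apply: (@is_cvg_series_dominated _ _ (fun k => B * oblong_inv R k)) => [|k].
  by apply: (@is_cvg_seriesZ _ _ B); apply/cvg_ex; exists 2; exact: cvg_oblong_inv.
have k0 : 0 < k.+1%:R :> R by rewrite ltr0n.
apply: (@le_trans _ _ (B * k.+1%:R ^- 2)); last first.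
  rewrite ler_wpM2l ?inv_sqr_le_oblong//.
  by rewrite /B mulr_ge0 ?invr_ge0 ?exprn_ge0 ?mulr_ge0 ?invr_ge0 ?(ltW d0) ?(ltW K0).
rewrite normrM normrX.
apply: (@le_trans _ _ (C * k.+1%:R ^+ p * K ^+ k)).
  by apply: ler_pM => //; apply: lerXn2r; rewrite ?nnegrE// ltW.
have -> : K ^+ k = K^-1 * expR (- (d * k.+1%:R)).
  by rewrite -mulNr expRM_natr /d opprK lnK ?posrE// exprS mulKf ?gt_eqF.
have dk0 : 0 < d * k.+1%:R by rewrite mulr_gt0.
have h := expRN_le p.+2 dk0.
have CK0 : 0 <= C * k.+1%:R ^+ p / K by rewrite divr_ge0 ?mulr_ge0 ?exprn_ge0 ?(ltW K0).
rewrite mulrA; apply: (le_trans (ler_wpM2l CK0 h)).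
rewrite le_eqVlt; apply/orP; left; apply/eqP; rewrite /B exprMn.
rewrite -[p.+2]addn2 [k.+1%:R ^+ (p + 2)]exprD.
move: (K) (d) (k.+1%:R) K0 d0 k0 => L e x L0 e0 x0.
by field; rewrite !expf_neq0 ?gt_eqF.
Qed.

(** The coefficients of [(1 - z) `^ (- 3 / 2)]. *)
Definition binom_coef (R : realType) (k : nat) : R :=
  pochhammer (3 / 2) k / k`!%:R.

Lemma pochhammer0 (R : realType) (a : R) : pochhammer a 0 = 1.
Proof. by rewrite /pochhammer big_ord0. Qed.

Lemma pochhammerS (R : realType) (a : R) k :
  pochhammer a k.+1 = pochhammer a k * (a + k%:R).
Proof. by rewrite /pochhammer big_ord_recr. Qed.

Lemma binom_coefS (R : realType) k :
  k.+1%:R * binom_coef R k.+1 = (k%:R + 3 / 2) * binom_coef R k.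
Proof.
rewrite /binom_coef pochhammerS factS natrM; field.
by rewrite nat1r !pnatr_eq0 -lt0n fact_gt0.
Qed.

Lemma binom_coef_itv (R : realType) k : 0 <= binom_coef R k <= k.+1%:R.
Proof.
elim: k => [|k /andP[IH0 IH1]].
  by rewrite /binom_coef pochhammer0 fact0 divr1 ler01 lexx.
have k0 : 0 < k.+1%:R :> R by rewrite ltr0n.
have kE : k.+1%:R = k%:R + 1 :> R by rewrite natr1.
have k2E : k.+2%:R = k%:R + 2 :> R by rewrite -natr1 kE; ring.
have k00 : 0 <= k%:R :> R by [].
apply/andP; split.
  by rewrite -(pmulr_rge0 _ k0) binom_coefS mulr_ge0//; lra.
rewrite -(ler_pM2l k0).
by rewrite binom_coefS kE k2E in IH1 *; nra.
Qed.

Lemma binom_coef_ge0 (R : realType) k : 0 <= binom_coef R k.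
Proof. by have /andP[] := binom_coef_itv R k. Qed.

(** The sum [f] satisfies [(1 - z) f' = 3/2 f], so [f (1 - z)^(3/2)] is
    constant. *)
Lemma cvg_binom_series (R : realType) (z : R) : `|z| < 1 ->
  series (fun k => binom_coef R k * z ^+ k) @ \oo --> ((1 - z) `^ (3 / 2))^-1.
Proof.
pose b := binom_coef R.
have dE : pseries_diffs b = fun k => (k%:R + 3 / 2) * b k.
  by apply/funext => k; rewrite /pseries_diffs binom_coefS.
have bb k : `|b k| <= 1 * k.+1%:R ^+ 1.
  by rewrite mul1r expr1 ger0_norm; have /andP[] := binom_coef_itv R k.
have dbb k : `|pseries_diffs b k| <= 2 * k.+1%:R ^+ 2.
  have k00 : 0 <= k%:R :> R by [].
  have bk := bb k; rewrite mul1r expr1 in bk.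
  have a0 : 0 <= k%:R + 3 / 2 :> R by lra.
  rewrite dE normrM (ger0_norm a0) expr2 mulrA; apply: ler_pM => //.
  by rewrite -natr1; lra.
have ddbb k : `|pseries_diffs (pseries_diffs b) k| <= 12 * k.+1%:R ^+ 3.
  rewrite {1}/pseries_diffs normrM ger0_norm//.
  apply: (le_trans (ler_wpM2l _ (dbb k.+1))) => //.
  have k1 : 1 <= k.+1%:R :> R by rewrite ler1n.
  rewrite -(natr1 k.+1); move: (k.+1%:R) k1 => x x1.
  by rewrite exprS mulrCA; nra.
pose f (x : R) : R := limn (pseries b x).
have df (x : R) : `|x| < 1 -> is_derive x 1 f (limn (pseries (pseries_diffs b) x)).
  move=> x1; pose K := (1 + `|x|) / 2.
  have x0 : 0 <= `|x| by [].
  have K0 : 0 <= K by rewrite /K; lra.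
  have K1 : `|K| < 1 by rewrite ger0_norm// /K; lra.
  apply: (@pseries_snd_diffs _ _ K).
  - exact: is_cvg_pseries_poly bb K1.
  - exact: is_cvg_pseries_poly dbb K1.
  - exact: is_cvg_pseries_poly ddbb K1.
  - by rewrite (ger0_norm K0) /K; lra.
have ode (x : R) : `|x| < 1 -> (1 - x) * limn (pseries (pseries_diffs b) x) = 3 / 2 * f x.
  move=> x1; have c1 := is_cvg_pseries_poly dbb x1.
  have c0 := is_cvg_pseries_poly bb x1.
  have c2 := pseries_diffs_equiv c1.
  set S := limn _ in c2 *.
  have : series (fun i => x * (i%:R * b i * x ^+ i.-1) + 3 / 2 * (b i * x ^+ i)) n
      @[n --> \oo] --> x * S + 3 / 2 * f x.
    under eq_fun do rewrite /series /= big_split -!big_distrr /=.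
    apply: cvgD; first by apply: cvgMr; exact: c2.
    by apply: cvgMr; exact: c0.
  have -> : (fun i => x * (i%:R * b i * x ^+ i.-1) + 3 / 2 * (b i * x ^+ i)) =
      (fun i => pseries_diffs b i * x ^+ i).
    apply/funext => -[|i]; first by rewrite dE expr0; ring.
    by rewrite dE /= [x ^+ i.+1]exprS; ring.
  move=> /cvg_lim e; have {}e : S = x * S + 3 / 2 * f x by rewrite -e.
  by rewrite mulrBl mul1r {1}e; ring.
pose g := f * (expR \o (fun x => 3 / 2 * ln (1 - x))).
have dg (x : R) : `|x| < 1 -> is_derive x 1 g 0.
  move=> x1; have x1' : 0 < 1 - x by rewrite subr_gt0 (le_lt_trans (ler_norm x)).
  have d1 := df _ x1.
  have d2 : is_derive x 1 (fun x : R => 1 - x) (- 1).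
    by have := is_deriveB (is_derive_cst (1 : R) x (1 : R)) (is_derive_id x (1 : R)); rewrite sub0r.
  have d3 := is_derive1_comp (g := fun x : R => 1 - x) (is_derive1_ln x1') d2.
  have d4 : is_derive x 1 (fun x => 3 / 2 * ln (1 - x)) (3 / 2 * ((1 - x)^-1 * - 1)).
    by apply: (@is_deriveZ _ _ _ (@ln R \o (fun x : R => 1 - x))).
  have d5 := is_derive1_comp (g := fun x => 3 / 2 * ln (1 - x)) (is_derive_expR _) d4.
  apply: is_derive_eq; rewrite /GRing.scale /=.
  have := ode _ x1; set S := limn _; set E := expR _ => o.
  have xn0 : 1 - x != 0 by rewrite gt_eqF.
  have -> : f x * (E * (3 / 2 * ((1 - x)^-1 * -1))) + E * S =
    E / (1 - x) * ((1 - x) * S - 3 / 2 * f x) by field.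
  by rewrite o subrr mulr0.
have gcst (a c : R) : a <= c -> (forall x, x \in `[a, c] -> `|x| < 1) -> g a = g c.
  move=> ac h.
  have hd (x : R) : x \in `]a, c[ -> is_derive x 1 g ((fun=> 0) x).
    move=> xac; apply: dg; apply: h; move: xac.
    by rewrite !in_itv/= => /andP[/ltW -> /ltW ->].
  have hc : {within `[a, c], continuous g}.
    by apply: derivable_within_continuous => y /h /dg [].
  by have [x _ /eqP] := MVT_segment ac hd hc; rewrite mul0r subr_eq0 => /eqP.
move=> z1.
have g0 : g z = g 0.
  have [z0|z0] := leP 0 z.
    apply/esym/gcst => // x; rewrite in_itv/= => /andP[x0 xz].
    by rewrite ger0_norm// (le_lt_trans xz)// (le_lt_trans (ler_norm z)).
  apply: gcst => [|x]; first exact: ltW.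
  rewrite in_itv/= => /andP[zx x0]; rewrite ler0_norm//.
  by apply: le_lt_trans z1; rewrite ltr0_norm// lerN2.
have f0 : f 0 = 1.
  apply: lim_near_cst => //; near=> n.
  have n0 : (0 < n)%N by near: n; exists 1%N.
  rewrite /pseries /series /= -(prednK n0) big_nat_recl// expr0 mulr1 big1.
    by rewrite /b /binom_coef pochhammer0 fact0 divr1 addr0.
  by move=> k _; rewrite expr0n mulr0.
have z1' : 0 < 1 - z by rewrite subr_gt0 (le_lt_trans (ler_norm z)).
have : f z = ((1 - z) `^ (3 / 2))^-1.
  move: g0; rewrite /g !fctE /= f0 mul1r subr0 ln1 mulr0 expR0.
  rewrite /powR gt_eqF// => e.
  have E0 : expR (3 / 2 * ln (1 - z)) != 0 by rewrite expR_eq0.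
  by apply: (mulIf E0); rewrite e mulVf.
move=> <-; exact: is_cvg_pseries_poly bb z1.
Unshelve. all: by end_near. Qed.

(** * Dominated convergence and the substitution x -> 1 / x *)

Lemma cvg_Rintegral_dominated d (T : measurableType d) (R : realType)
    (mu : {measure set T -> \bar R}) (D : set T) (f_ : (T -> R)^nat) (f g : T -> R) :
  measurable D -> (forall n, measurable_fun D (f_ n)) ->
  (forall x, D x -> f_ n x @[n --> \oo] --> f x) ->
  mu.-integrable D (EFin \o g) -> (forall n x, D x -> `|f_ n x| <= g x) ->
  mu.-integrable D (EFin \o f) /\
  \int[mu]_(x in D) f_ n x @[n --> \oo] --> \int[mu]_(x in D) f x.
Proof.
move=> mD mf_ f_f ig f_g.
have mf : measurable_fun D f by exact: measurable_fun_cvg mf_ f_f.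
have [] := @dominated_convergence _ _ _ mu D mD (fun n => EFin \o f_ n) (EFin \o f) (EFin \o g).
- by move=> n; exact/measurable_EFinP.
- exact/measurable_EFinP.
- by apply: aeW => x Dx; apply: cvg_EFin; [near=> n|exact: f_f].
- exact: ig.
- by apply: aeW => x n Dx; rewrite /= lee_fin f_g.
move=> if_ _ c; split => //; apply: fine_cvg.
by rewrite fineK//; exact: integrable_fin_num.
Unshelve. all: by end_near. Qed.

Lemma Rintegral_sum_nat d (T : measurableType d) (R : realType)
    (mu : {measure set T -> \bar R}) (D : set T) (h : nat -> T -> R) N :
  measurable D -> (forall k, mu.-integrable D (EFin \o h k)) ->
  mu.-integrable D (EFin \o (fun x => \sum_(0 <= k < N) h k x)) /\
  \int[mu]_(x in D) (\sum_(0 <= k < N) h k x) =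
  \sum_(0 <= k < N) \int[mu]_(x in D) h k x.
Proof.
move=> mD ih; elim: N => [|N [IH1 IH2]].
  rewrite big_geq//; under eq_Rintegral do rewrite big_geq//.
  rewrite Rintegral_cst// mul0r; split => //.
  apply: eq_integrable (integrable0 _ _) => // x _ /=.
  by rewrite big_geq.
split.
  apply: eq_integrable (integrableD mD IH1 (ih N)) => // x _ /=.
  by rewrite big_nat_recr//= EFinD.
rewrite big_nat_recr//= -IH2 -RintegralD//.
by under eq_Rintegral do rewrite big_nat_recr//=.
Qed.

Section inversion.
Context {R : realType}.
Local Notation mu := (@lebesgue_measure R).

Lemma integral_itv_inv (f : R -> R) (b : R) : 1 <= b ->
  (forall x, 0 < x -> {for x, continuous f}) ->
  (\int[mu]_(x in `[(b^-1)%R, b]) (f x)%:E =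
   \int[mu]_(x in `[(b^-1)%R, b]) (f x^-1 / x ^+ 2)%R%:E)%E.
Proof.
move=> b1 cf.
have b0 : 0 < b by apply: lt_le_trans b1.
have bi0 : 0 < b^-1 by rewrite invr_gt0.
have bib : b^-1 <= b by rewrite (le_trans _ b1)// invf_le1.
have dinv (x : R) : 0 < x -> is_derive x 1 (fun z : R => z^-1) (- x ^- 2).
  move=> x0; have xn0 : x != 0 by rewrite gt_eqF.
  have := @is_deriveV R id x 1 1 xn0 (is_derive_id x 1).
  by rewrite /GRing.scale /= mulr1.
have cinv (x : R) : 0 < x -> {for x, continuous (fun z : R => z^-1)}.
  by move=> x0; apply: inv_continuous; rewrite gt_eqF.
have dE (x : R) : 0 < x -> derive1 (fun z : R => z^-1) x = - x ^- 2.
  by move=> x0; rewrite derive1E; have [_] := dinv x x0.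
have cd (x : R) : 0 < x -> {for x, continuous (derive1 (fun z : R => z^-1))}.
  move=> x0; rewrite /prop_for /continuous_at dE//.
  have c : - z ^- 2 @[z --> x] --> - x ^- 2.
    apply: cvgN; apply: cvgV; first by rewrite gt_eqF ?exprn_gt0.
    exact: exprn_continuous.
  apply: cvg_trans c; apply: near_eq_cvg; near=> z; rewrite dE//.
  by near: z; exact: lt_nbhsr.
have := @integration_by_substitution_decreasing R (fun z => z^-1) f _ _ bib.
rewrite invrK => ->.
- apply: eq_integral => x; rewrite inE/= in_itv/= => /andP[bx _].
  by rewrite !fctE /= dE ?opprK// (lt_le_trans bi0).
- move=> x y; rewrite !in_itv/= => /andP[bx _] /andP[bx' _] xy.
  by rewrite ltf_pV2// posrE (lt_le_trans bi0).
- by move=> x; rewrite in_itv/= => /andP[bx _]; apply: cd; exact: lt_trans bx.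
- by apply/cvg_ex; eexists; apply: cvg_at_right_filter; exact: cd.
- by apply/cvg_ex; eexists; apply: cvg_at_left_filter; exact: cd.
- split.
  + by move=> x; rewrite in_itv/= => /andP[bx _]; have [] := dinv x (lt_trans bi0 bx).
  + by apply: cvg_at_right_filter; exact: cinv.
  + by apply: cvg_at_left_filter; exact: cinv.
- apply: continuous_in_subspaceT => x; rewrite inE/= in_itv/= => /andP[bx _].
  by apply: cf; exact: lt_le_trans bx.
Unshelve. all: by end_near. Qed.

(** On [[b^-1, b]] the substitution shows that the integral is its own opposite;
    the whole half-line is the limit as [b] tends to infinity. *)
Lemma Rintegral_inv_antisym (f : R -> R) :
  (forall x, 0 < x -> {for x, continuous f}) ->
  mu.-integrable `]0, +oo[ (EFin \o f) ->
  (forall x, 0 < x -> f x^-1 / x ^+ 2 = - f x) ->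
  \int[mu]_(x in `]0, +oo[) f x = 0.
Proof.
move=> cf intf finv.
pose b (n : nat) : R := n.+1%:R.
have b1 n : 1 <= b n by rewrite ler1n.
have b0 n : 0 < b n by rewrite ltr0n.
pose I n := `[(b n)^-1, b n]%classic.
have sI n : I n `<=` `]0, +oo[.
  move=> x; rewrite /= !in_itv/= => /andP[bx _]; rewrite andbT.
  by rewrite bnd_simp in bx; apply: lt_le_trans bx; rewrite invr_gt0.
have iI n : mu.-integrable (I n) (EFin \o f).
  have h := @integrableS _ _ R mu `]0%R, +oo[%classic (I n) (EFin \o f).
  by apply: h; [exact: measurable_itv|exact: measurable_itv|exact: sI|].
have zero n : \int[mu]_(x in I n) f x = 0.
  have e : \int[mu]_(x in I n) f x = \int[mu]_(x in I n) (-1 * f x).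
    rewrite {1}/Rintegral integral_itv_inv//; congr fine.
    apply: eq_integral => x; rewrite inE => /sI /=.
    by rewrite in_itv/= andbT => x0; rewrite finv// mulN1r.
  have mI : measurable (I n) by exact: measurable_itv.
  have := @RintegralZl _ _ R mu (I n) f (-1) mI (iI n); rewrite -e.
  by move: (Rintegral _ _ _) => r; clear; lra.
have [] := @cvg_Rintegral_dominated _ _ R mu `]0%R, +oo[%classic
   (fun n => f \_ (I n)) f (fun x => `|f x|).
- by [].
- move=> n; apply/(measurable_restrict _ _ _) => //.
    exact: measurable_itv.
  have mf : measurable_fun (`]0%R, +oo[%classic : set R) f.
    by apply/measurable_EFinP; apply: measurable_int intf.
  apply: measurable_funS mf; first exact: measurable_itv.
  exact: subIsetl.
- move=> x; rewrite /= in_itv/= andbT => x0; apply: cvg_near_cst; near=> n.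
  rewrite patchT// inE /I /= in_itv/=; apply/andP; split.
    rewrite invf_ple ?posrE// /b -natr1.
    apply: (@le_trans _ _ n%:R); last by rewrite lerDl.
    by near: n; exact: nbhs_infty_ger.
  rewrite /b -natr1; apply: (@le_trans _ _ n%:R); last by rewrite lerDl.
  by near: n; exact: nbhs_infty_ger.
- exact: integrable_norm.
- by move=> n x _; rewrite /patch; case: ifP => // _; rewrite normr0.
move=> _ c; rewrite -(cvg_lim _ c)//.
apply: lim_near_cst => //; near=> n.
rewrite -[RHS](zero n) -Rintegral_mkcondr; congr (Rintegral _ _ _).
by apply: setIidr; exact: sI.
Unshelve. all: by end_near. Qed.

End inversion.

(** * Moments of omega *)

Section moments.
Context {R : realType}.
Implicit Types x z : R.
Local Notation mu := (@lebesgue_measure R).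
Local Notation Rpos := (`]0%R, +oo[%classic : set (measurableTypeR R)).

Definition mobius x : R := (x - 1) / (x + 1).

Definition omega_weight x : R := omega x / (x + 1) `^ (3 / 2).

Definition moment (k : nat) : R :=
  \int[mu]_(x in Rpos) (omega_weight x * mobius x ^+ k).

(** The sum over [k] of [binom_coef k * `|omega_weight x * mobius x ^+ k|]. *)
Definition moment_majorant x : R :=
  `|omega_weight x| * ((1 - `|mobius x|) `^ (3 / 2))^-1.

Let RposE x : Rpos x = (0 < x).
Proof. by rewrite /= in_itv/= andbT. Qed.

Let mRpos : measurable Rpos.
Proof. exact: measurable_itv. Qed.

Lemma mobius_lt1 x : 0 < x -> `|mobius x| < 1.
Proof.
move=> x0; have x10 : 0 < x + 1 by rewrite ltr_wpDr// ltW.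
rewrite ltr_norml /mobius ltr_pdivlMr// ltr_pdivrMr//.
by apply/andP; split; lra.
Qed.

Lemma mobius_inv x : 0 < x -> mobius x^-1 = - mobius x.
Proof.
move=> x0; rewrite /mobius; have xn0 : x != 0 by rewrite gt_eqF.
have x10 : x + 1 != 0 by rewrite gt_eqF// ltr_wpDr// ltW.
by field; rewrite x10 xn0.
Qed.

Lemma omega_weight_inv x : 0 < x -> omega_weight x^-1 / x ^+ 2 = omega_weight x.
Proof.
move=> x0; have xn0 : x != 0 by rewrite gt_eqF.
have x10 : 0 < x + 1 by rewrite ltr_wpDr// ltW.
have s0 : 0 < Num.sqrt x by rewrite sqrtr_gt0.
rewrite /omega_weight omega_inv//.
have -> : (x + 1) `^ (3 / 2) = x `^ (3 / 2) * (x^-1 + 1) `^ (3 / 2).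
  rewrite -powRM ?(ltW x0) ?addr_ge0 ?invr_ge0 ?(ltW x0)//; congr powR.
  by field.
have xi0 : 0 < x^-1 + 1 by rewrite ltr_wpDr// invr_gt0.
have p0 := powR_gt0 (3 / 2) xi0.
rewrite (powR32 x0); move: (_ `^ _) p0 => P P0.
have -> : x ^+ 2 = x * Num.sqrt x ^+ 2 by rewrite sqr_sqrtr ?ltW.
by field; rewrite !gt_eqF.
Qed.

Lemma continuous_mobius x : 0 < x -> {for x, continuous mobius}.
Proof.
move=> x0; have x10 : 0 < x + 1 by rewrite ltr_wpDr// ltW.
apply: cvgM; first by apply: cvgB; [exact: cvg_id|exact: cvg_cst].
apply: cvgV; first by rewrite gt_eqF.
by apply: cvgD; [exact: cvg_id|exact: cvg_cst].
Qed.

Lemma continuous_powR_gt0 (a y : R) : 0 < y -> {for y, continuous (@powR R ^~ a)}.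
Proof.
move=> y0; apply/differentiable_continuous/derivable1_diffP/derivable_powR.
by rewrite in_itv/= y0.
Qed.

Lemma continuous_omega_weight x : 0 < x -> {for x, continuous omega_weight}.
Proof.
move=> x0; have x10 : 0 < x + 1 by rewrite ltr_wpDr// ltW.
apply: cvgM; first exact: continuous_omega.
apply: cvgV; first by rewrite gt_eqF// powR_gt0.
apply: (@continuous_cvg _ _ _ _ _ (fun x => x + 1) (@powR R ^~ (3 / 2))).
  exact: continuous_powR_gt0.
by apply: cvgD; [exact: cvg_id|exact: cvg_cst].
Qed.

Lemma continuous_moment k x : 0 < x ->
  {for x, continuous (fun x => omega_weight x * mobius x ^+ k)}.
Proof.
move=> x0; apply: cvgM; first exact: continuous_omega_weight.
apply: (@continuous_cvg _ _ _ _ _ mobius (fun x => x ^+ k)).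
  exact: exprn_continuous.
exact: continuous_mobius.
Qed.

Lemma continuous_moment_majorant x : 0 < x -> {for x, continuous moment_majorant}.
Proof.
move=> x0; have m1 : 0 < 1 - `|mobius x| by rewrite subr_gt0 mobius_lt1.
apply: cvgM; first by apply: cvg_norm; exact: continuous_omega_weight.
apply: cvgV; first by rewrite gt_eqF// powR_gt0.
apply: (@continuous_cvg _ _ _ _ _ (fun x => 1 - `|mobius x|) (@powR R ^~ (3 / 2))).
  exact: continuous_powR_gt0.
apply: cvgB; first exact: cvg_cst.
by apply: cvg_norm; exact: continuous_mobius.
Qed.

Let measurable_Rpos (f : R -> R) :
  (forall x, 0 < x -> {for x, continuous f}) -> measurable_fun Rpos f.
Proof.
move=> cf; apply: open_continuous_measurable_fun; first exact: interval_open.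
by move=> x; rewrite inE RposE; exact: cf.
Qed.

Lemma moment_majorant_ge0 x : 0 <= moment_majorant x.
Proof. by rewrite /moment_majorant mulr_ge0 ?invr_ge0 ?powR_ge0. Qed.

Lemma integrable_moment_majorant : mu.-integrable Rpos (EFin \o moment_majorant).
Proof.
have [C hC] := omega_weight_le R.
have io : mu.-integrable Rpos (EFin \o (fun x => (oneDsqr x)^-1)).
  have i0 : mu.-integrable (`[0%R, +oo[%classic : set R) (EFin \o (fun x => (oneDsqr x)^-1)).
    apply/integrableP; split.
      apply/measurable_EFinP; apply: measurable_funTS.
      exact: continuous_measurable_fun (@continuous_oneDsqrV R).
    have -> : (\int[mu]_(x in `[0%R, +oo[) `|(oneDsqr x)^-1%:E| =
        \int[mu]_(x in `[0%R, +oo[) (oneDsqr x)^-1%:E)%E.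
      by apply: eq_integral => x _; rewrite gee0_abs// lee_fin invr_ge0.
    by rewrite integral0y_oneDsqr ltry.
  have h := @integrableS _ _ R mu (`[0%R, +oo[%classic : set R) Rpos _ _ _ _ i0.
  apply: h => //.
  by move=> x; rewrite /= !in_itv/= !andbT => /ltW.
apply: (le_integrable mRpos _ _ (integrableZl mRpos C io)).
  apply/measurable_EFinP; apply: measurable_Rpos => x.
  exact: continuous_moment_majorant.
move=> x; rewrite RposE => x0; rewrite /= lee_fin.
rewrite (ger0_norm (moment_majorant_ge0 x)).
by apply: le_trans (ler_norm _); exact: hC.
Qed.

Lemma integrable_le_majorant (f : R -> R) C :
  (forall x, 0 < x -> {for x, continuous f}) ->
  (forall x, 0 < x -> `|f x| <= C * moment_majorant x) ->
  mu.-integrable Rpos (EFin \o f).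
Proof.
move=> cf hf.
apply: (le_integrable mRpos _ _ (integrableZl mRpos C integrable_moment_majorant)).
  by apply/measurable_EFinP; exact: measurable_Rpos.
move=> x; rewrite RposE => x0; rewrite /= lee_fin.
by apply: le_trans (ler_norm _); exact: hf.
Qed.

Lemma powR_invr_ge1 z : 0 <= z < 1 -> 1 <= ((1 - z) `^ (3 / 2))^-1.
Proof.
move=> /andP[z0 z1]; have z10 : 0 < 1 - z by rewrite subr_gt0.
rewrite invf_ge1 ?powR_gt0//.
apply: (@le_trans _ _ (1 `^ (3 / 2))); last by rewrite powR1.
by apply: ge0_ler_powR; rewrite ?nnegrE ?divr_ge0// ?(ltW z10)//; lra.
Qed.

Lemma moment_integrand_le k x : 0 < x ->
  `|omega_weight x * mobius x ^+ k| <= moment_majorant x.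
Proof.
move=> x0; have m1 := mobius_lt1 x0.
rewrite /moment_majorant normrM ler_wpM2l//.
apply: (@le_trans _ _ 1); first by rewrite normrX exprn_ile1// ltW.
by apply: powR_invr_ge1; rewrite normr_ge0.
Qed.

Lemma integrable_moment k :
  mu.-integrable Rpos (EFin \o (fun x => omega_weight x * mobius x ^+ k)).
Proof.
apply: (@integrable_le_majorant _ 1); first by move=> x; exact: continuous_moment.
by move=> x x0; rewrite mul1r moment_integrand_le.
Qed.

(** The substitution [x -> 1 / x] preserves the weight and changes the sign of
    [mobius]. *)
Lemma moment_odd k : odd k -> moment k = 0.
Proof.
move=> ok; apply: Rintegral_inv_antisym.
- by move=> x; exact: continuous_moment.
- exact: integrable_moment.
move=> x x0; rewrite mobius_inv// exprNn -signr_odd ok expr1 mulN1r.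
by rewrite mulrN mulNr mulrAC omega_weight_inv.
Qed.

(** Dominated convergence: the hypothesis on [beta] bounds all the partial sums by
    [A * moment_majorant]. *)
Lemma cvg_moment_series (beta : nat -> R) (kappa : nat -> nat) (A : R) :
  (forall z N, 0 <= z < 1 ->
    \sum_(0 <= j < N) `|beta j| * z ^+ kappa j <= A * ((1 - z) `^ (3 / 2))^-1) ->
  mu.-integrable Rpos (EFin \o (fun x => omega_weight x *
    limn (series (fun j => beta j * mobius x ^+ kappa j)))) /\
  (series (fun j => beta j * moment (kappa j)) @ \oo -->
  \int[mu]_(x in Rpos)
    (omega_weight x * limn (series (fun j => beta j * mobius x ^+ kappa j)))).
Proof.
move=> H.
pose h j x := omega_weight x * (beta j * mobius x ^+ kappa j).
have ch x : 0 < x -> cvgn (series (fun j => beta j * mobius x ^+ kappa j)).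
  move=> x0; apply: normed_cvg; rewrite /normed_series_of /=.
  apply: nondecreasing_is_cvgn.
    by apply/nondecreasing_seqP => n; rewrite /series /= big_nat_recr//= lerDl.
  exists (A * ((1 - `|mobius x|) `^ (3 / 2))^-1) => _ [n _ <-].
  rewrite /series /=; under eq_bigr do rewrite normrM normrX.
  by apply: H; rewrite normr_ge0 mobius_lt1.
have ih j : mu.-integrable Rpos (EFin \o h j).
  apply: eq_integrable (integrableZl mRpos (beta j) (integrable_moment (kappa j))) => //.
  by move=> x _ /=; rewrite /h mulrCA EFinM.
have [||||if_ cf] := @cvg_Rintegral_dominated _ _ R mu Rpos
  (fun n x => \sum_(0 <= j < n) h j x)
  (fun x => omega_weight x * limn (series (fun j => beta j * mobius x ^+ kappa j)))
  (fun x => A * moment_majorant x) mRpos.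
- move=> n; apply: measurable_sum => j.
  by apply/measurable_EFinP; apply: measurable_int (ih j).
- move=> x; rewrite RposE => x0; rewrite /h.
  under eq_fun do rewrite -big_distrr /=.
  by apply: cvgMr; exact: ch.
- exact: eq_integrable (integrableZl mRpos A integrable_moment_majorant).
- move=> n x; rewrite RposE => x0; rewrite /h -big_distrr /= normrM.
  rewrite /moment_majorant mulrCA ler_wpM2l//.
  apply: (le_trans (ler_norm_sum _ _ _)).
  under eq_bigr do rewrite normrM normrX.
  by apply: H; rewrite normr_ge0 mobius_lt1.
split; first exact: if_.
have -> : series (fun j => beta j * moment (kappa j)) =
    (fun n => \int[mu]_(x in Rpos) (\sum_(0 <= j < n) h j x)); last by [].
apply/funext => n.
have [_ ->] := Rintegral_sum_nat n mRpos ih.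
apply: eq_bigr => j _; rewrite /moment -RintegralZl//.
  by apply: eq_Rintegral => x _; rewrite /h mulrCA.
exact: integrable_moment.
Qed.

Lemma binom_sum_le z N : 0 <= z < 1 ->
  \sum_(0 <= k < N) binom_coef R k * z ^+ k <= ((1 - z) `^ (3 / 2))^-1.
Proof.
move=> /andP[z0 z1]; have z1' : `|z| < 1 by rewrite ger0_norm.
have c := cvg_binom_series z1'; rewrite -(cvg_lim _ c)//.
apply: (nondecreasing_cvgn_le _ (cvgP _ c)).
apply/nondecreasing_seqP => n; rewrite /series /= big_nat_recr//= lerDl.
by rewrite mulr_ge0 ?exprn_ge0// binom_coef_ge0.
Qed.

Lemma is_cvg_binom_moment : cvgn (series (fun k => binom_coef R k * `|moment k|)).
Proof.
pose h k x := binom_coef R k * `|omega_weight x * mobius x ^+ k|.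
have ih k : mu.-integrable Rpos (EFin \o h k).
  have i := integrable_norm (integrable_moment k).
  exact: eq_integrable (integrableZl mRpos (binom_coef R k) i).
apply: nondecreasing_is_cvgn.
  apply/nondecreasing_seqP => n; rewrite /series /= big_nat_recr//= lerDl.
  by rewrite mulr_ge0// binom_coef_ge0.
exists (\int[mu]_(x in Rpos) moment_majorant x) => _ [n _ <-].
apply: (@le_trans _ _ (\int[mu]_(x in Rpos) (\sum_(0 <= k < n) h k x))).
  have [_ ->] := Rintegral_sum_nat n mRpos ih.
  rewrite /series /=; apply: ler_sum => k _; rewrite /h RintegralZl//.
    rewrite ler_wpM2l ?binom_coef_ge0//; apply: le_normr_Rintegral => //.
    exact: integrable_moment.
  exact: integrable_norm (integrable_moment k).
have [i1 _] := Rintegral_sum_nat n mRpos ih.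
apply: le_Rintegral => //; first exact: integrable_moment_majorant.
move=> x; rewrite RposE => x0; rewrite /h /moment_majorant.
under eq_bigr do rewrite normrM normrX mulrCA.
rewrite -big_distrr /= ler_wpM2l// binom_sum_le//.
by rewrite normr_ge0 mobius_lt1.
Qed.

End moments.

(** * Even powers in the Chebyshev basis *)

Section chebyshev.
Context {R : realType}.
Implicit Types t : R.

(** The ballot numbers divided by [4 ^+ i]; see [expr_chebyU]. *)
Definition ballot (i l : nat) : R :=
  ('C(i.*2, i + l)%:R - 'C(i.*2, (i + l).+1)%:R) / 4 ^+ i.

Lemma ballot_small i l : (i < l)%N -> ballot i l = 0.
Proof. by move=> il; rewrite /ballot !bin_small ?subrr ?mul0r//; lia. Qed.

Lemma ballotE i l :
  (i + l).+1%:R * ballot i l = (l.*2.+1)%:R * ('C(i.*2, i + l)%:R / 4 ^+ i).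
Proof.
have [li|il] := leqP l i; last first.
  by rewrite ballot_small// mulr0 bin_small ?mul0r ?mulr0//; lia.
have := congr1 (fun n => n%:R : R) (mul_bin_left i.*2 (i + l)); rewrite !natrM.
have -> : (i.*2 - (i + l) = i - l)%N by lia.
rewrite natrB// => e; rewrite /ballot !mulrA mulrBr e.
rewrite -(natr1 (i + l)) -(natr1 l.*2) natrD.
by rewrite -[l.*2]muln2 natrM; ring.
Qed.

Lemma ballot_ge0 i l : 0 <= ballot i l.
Proof.
have h : 0 < (i + l).+1%:R :> R by rewrite ltr0n.
by rewrite -(pmulr_rge0 _ h) ballotE mulr_ge0// divr_ge0// exprn_ge0.
Qed.

Lemma ballotS0 i : 4 * ballot i.+1 0 = ballot i 0 + ballot i 1.
Proof.
rewrite /ballot !addn0 addn1 exprS doubleS.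
have -> : 'C(i.*2.+2, i.+1) = (2 * ('C(i.*2, i.+1) + 'C(i.*2, i)))%N.
  rewrite binS; have -> : 'C(i.*2.+1, i) = 'C(i.*2.+1, i.+1).
    by rewrite -(@bin_sub i.*2.+1 i.+1); [congr 'C(_, _); lia|lia].
  by rewrite binS addnn mul2n.
have -> : 'C(i.*2.+2, i.+2) = ('C(i.*2, i.+2) + 2 * 'C(i.*2, i.+1) + 'C(i.*2, i))%N.
  by rewrite !binS; lia.
by rewrite !(natrM, natrD); field; rewrite expf_neq0.
Qed.

Lemma ballotSS i l :
  4 * ballot i.+1 l.+1 = ballot i l + 2 * ballot i l.+1 + ballot i l.+2.
Proof.
rewrite /ballot !addnS !addSn exprS doubleS !binS !natrD.
by field; rewrite expf_neq0.
Qed.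

Lemma chebyU_eval_rec n t :
  (chebyU n.+2).[t] = 2 * t * (chebyU n.+1).[t] - (chebyU n).[t] :> R.
Proof. by rewrite chebyUSS hornerD hornerN !hornerM hornerC hornerX. Qed.

Lemma chebyU0_eval t : (chebyU 0).[t] = 1 :> R.
Proof. by rewrite chebyU0 hornerE. Qed.

Lemma chebyU1_eval t : (chebyU 1).[t] = 2 * t :> R.
Proof. by rewrite chebyU1 hornerM hornerC hornerX. Qed.

Lemma chebyU_mulX2_0 t : 4 * t ^+ 2 * (chebyU 0).[t] = (chebyU 2).[t] + (chebyU 0).[t].
Proof. by rewrite chebyU_eval_rec chebyU1_eval chebyU0_eval; ring. Qed.

Lemma chebyU_mulX2 n t : 4 * t ^+ 2 * (chebyU n.+2).[t] =
  (chebyU n.+4).[t] + 2 * (chebyU n.+2).[t] + (chebyU n).[t].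
Proof.
have h1 := chebyU_eval_rec n t; have h2 := chebyU_eval_rec n.+1 t.
have -> := chebyU_eval_rec n.+2 t; rewrite h2.
by rewrite {}h1; ring.
Qed.

(** Multiplication by [4 t ^+ 2] sends [U_n] to [U_(n+2) + 2 U_n + U_(n-2)], with
    [U_(-2) = - U_0]; its transpose is the recurrence that Pascal's rule gives for
    the ballot numbers. *)
Lemma expr_chebyU i t :
  t ^+ i.*2 = \sum_(0 <= l < i.+1) ballot i l * (chebyU l.*2).[t].
Proof.
elim: i => [|i IH].
  by rewrite big_nat1 /ballot addn0 bin0 bin0n subr0 expr0 divr1 mul1r chebyU0_eval.
have four : 4 != 0 :> R by [].
apply: (mulfI four); rewrite doubleS [t ^+ _.+2](exprD _ 2) mulrA IH !big_distrr /=.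
pose V l : R := (chebyU l.*2).[t]; pose a := ballot i.
have e1 l : 4 * t ^+ 2 * (a l.+1 * V l.+1) =
    a l.+1 * (V l.+2 + 2 * V l.+1 + V l).
  by rewrite mulrCA; congr (_ * _); exact: chebyU_mulX2.
have e0 : 4 * t ^+ 2 * (a 0%N * V 0%N) = a 0%N * (V 1%N + V 0%N).
  by rewrite mulrCA; congr (_ * _); exact: chebyU_mulX2_0.
rewrite big_nat_recl// e0; under eq_bigr do rewrite e1.
rewrite [RHS]big_nat_recl// (mulrA 4 (ballot _ _)) ballotS0.
under [in RHS]eq_bigr do rewrite (mulrA 4 (ballot _ _)) ballotSS.
rewrite -/(V 0%N) -/a.
have a_small l : (i < l)%N -> a l = 0 by exact: ballot_small.
have pad : \sum_(0 <= l < i) a l.+1 * V l.+2 + a 0%N * V 1%N =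
    \sum_(0 <= l < i.+1) a l * V l.+1 by rewrite big_nat_recl// addrC.
have pad1 : \sum_(0 <= l < i.+1) a l.+1 * V l.+1 = \sum_(0 <= l < i) a l.+1 * V l.+1.
  by rewrite big_nat_recr//= (a_small i.+1)// mul0r addr0.
have pad2 : \sum_(0 <= l < i.+1) a l.+2 * V l.+1 + a 1%N * V 0%N =
    \sum_(0 <= l < i) a l.+1 * V l.
  transitivity (\sum_(0 <= l < i.+2) a l.+1 * V l).
    by rewrite [RHS]big_nat_recl// addrC.
  rewrite !big_nat_recr//= (a_small i.+1)// (a_small i.+2)//.
  by rewrite !mul0r !addr0.
have -> : \sum_(0 <= l < i) a l.+1 * (V l.+2 + 2 * V l.+1 + V l) =
    \sum_(0 <= l < i) a l.+1 * V l.+2 + 2 * (\sum_(0 <= l < i) a l.+1 * V l.+1) +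
    \sum_(0 <= l < i) a l.+1 * V l.
  rewrite big_distrr -!big_split /=; apply: eq_bigr => l _; ring.
have -> : \sum_(0 <= l < i.+1) (a l + 2 * a l.+1 + a l.+2) * V l.+1 =
    \sum_(0 <= l < i.+1) a l * V l.+1 + 2 * (\sum_(0 <= l < i.+1) a l.+1 * V l.+1) +
    \sum_(0 <= l < i.+1) a l.+2 * V l.+1.
  rewrite big_distrr -!big_split /=; apply: eq_bigr => l _; ring.
by rewrite -pad pad1 -pad2; ring.
Qed.

Lemma chebyU_eval1 n : (chebyU n).[1] = n.+1%:R :> R.
Proof.
suff : (chebyU n).[1] = n.+1%:R :> R /\ (chebyU n.+1).[1] = n.+2%:R :> R by case.
elim: n => [|n [IH1 IH2]]; first by rewrite chebyU0_eval chebyU1_eval mulr1.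
split => //; rewrite chebyU_eval_rec IH1 IH2.
by rewrite -[n.+3%:R]natr1 -[n.+2%:R]natr1 -[n.+1%:R]natr1; ring.
Qed.

(** This is [expr_chebyU] at [t = 1].  It says that the bounds [n + 1] on the
    Chebyshev polynomials cost nothing in absolute convergence. *)
Lemma sum_ballot i : \sum_(0 <= l < i.+1) ballot i l * l.*2.+1%:R = 1.
Proof.
rewrite -[RHS](expr1n R i.*2) expr_chebyU.
by apply: eq_bigr => l _; rewrite chebyU_eval1.
Qed.

Lemma sum_ballot_le i N : \sum_(0 <= l < N) ballot i l * l.*2.+1%:R <= 1.
Proof.
have pos l : 0 <= ballot i l * l.*2.+1%:R by rewrite mulr_ge0// ballot_ge0.
apply: (@le_trans _ _ (\sum_(0 <= l < i.+1 + N) ballot i l * l.*2.+1%:R)).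
  by rewrite [leRHS](@big_cat_nat _ _ _ N)//= ?leq_addl// lerDl sumr_ge0.
rewrite (@big_cat_nat _ _ _ i.+1)//= ?leq_addr// sum_ballot.
rewrite big1_seq ?addr0// => l; rewrite mem_index_iota => /andP[_ /andP[il _]].
by rewrite ballot_small ?mul0r.
Qed.

Lemma ballot_le1 i l : ballot i l <= 1.
Proof.
apply: le_trans (sum_ballot_le i l.+1); rewrite big_nat_recr//=.
apply: (@le_trans _ _ (ballot i l * l.*2.+1%:R)).
  by rewrite ler_peMr ?ballot_ge0// ler1n.
by rewrite lerDr sumr_ge0// => k _; rewrite mulr_ge0// ballot_ge0.
Qed.

Lemma norm_sin_mul_le n (x : R) : `|sin (n%:R * x)| <= n%:R * `|sin x|.
Proof.
elim: n => [|n IH]; first by rewrite !mul0r sin0 normr0.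
rewrite -natr1 !mulrDl !mul1r sinD; apply: (le_trans (ler_normD _ _)).
rewrite !normrM; apply: lerD.
  by apply: le_trans IH; rewrite ler_piMr// cos_max.
by rewrite ler_piMl// cos_max.
Qed.

Lemma norm_chebyU_le n t : -1 < t < 1 -> `|(chebyU n).[t]| <= n.+1%:R.
Proof.
move=> /andP[t1 t2]; have tI : -1 <= t <= 1 by rewrite !ltW.
have s0 : 0 < sin (acos t).
  by apply: sin_gt0_pi; rewrite acos_gt0 ?acos_ltpi ?t1 ?t2 ?ltW.
have := norm_sin_mul_le n.+1 (acos t).
rewrite -chebyU_mul_sin normrM ler_pM2r ?normr_gt0 ?gt_eqF//.
by rewrite acosK// in_itv.
Qed.

End chebyshev.

(** * The coefficients and the remainder *)

Section expansion.
Context {R : realType}.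
Implicit Types x t z : R.
Local Notation mu := (@lebesgue_measure R).
Local Notation Rpos := (`]0%R, +oo[%classic : set (measurableTypeR R)).

(** The ratio of consecutive ballot numbers, from the closed form [ballotE]. *)
Lemma ballotSl i l : (l <= i)%N ->
  4 * ((i - l).+1%:R * (i + l).+2%:R) * ballot i.+1 l =
  (i.*2.+1%:R * i.*2.+2%:R) * ballot i l :> R.
Proof.
move=> li.
have h1 := congr1 (fun n => n%:R : R) (mul_bin_diag i.+1.*2 (i + l)).
have h2 := congr1 (fun n => n%:R : R) (mul_bin_down i.*2.+1 (i + l)).
have e : (i.*2.+1 - (i + l) = (i - l).+1)%N by lia.
rewrite /= !natrM e in h1 h2.
have b1 := @ballotE R i.+1 l; have b0 := @ballotE R i l.
rewrite doubleS addSn exprS in b1 h1 *.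
have s0 : (i + l).+1%:R != 0 :> R by rewrite pnatr_eq0.
have p0 : 4 ^+ i != 0 :> R by rewrite expf_neq0.
apply: (mulfI s0).
have -> : (i + l).+1%:R * (4 * ((i - l).+1%:R * (i + l).+2%:R) * ballot i.+1 l) =
  4 * (i - l).+1%:R * (i + l).+1%:R * ((i + l).+2%:R * ballot i.+1 l) :> R by ring.
rewrite b1.
have -> : (i + l).+1%:R * (i.*2.+1%:R * i.*2.+2%:R * ballot i l) =
  i.*2.+1%:R * i.*2.+2%:R * ((i + l).+1%:R * ballot i l) :> R by ring.
rewrite b0.
move: (i - l).+1%:R (i + l).+1%:R l.*2.+1%:R i.*2.+1%:R i.*2.+2%:R ('C(_, _)%:R)
  ('C(_, _)%:R) ('C(_, _)%:R) (4 ^+ i) h1 h2 p0 => p s L n1 n2 C0 C2 C1 F h1 h2 p0.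
have -> : 4 * p * s * (L * (C2 / (4 * F))) = p * (s * C2) * L / F by field.
rewrite -h1; have -> : p * (n2 * C1) * L / F = n2 * (p * C1) * L / F by ring.
by rewrite -h2; ring.
Qed.

Definition hyper_term (l j : nat) : R :=
  pochhammer (l.*2%:R / 2 + 3 / 4) j * pochhammer (l.*2%:R / 2 + 5 / 4) j /
  (pochhammer (l.*2%:R + 2) j * j`!%:R).

(** The factor in front of the integral in [dcoef], divided by [2 sqrt 2]. *)
Definition hyper_scale (l : nat) : R :=
  pochhammer (3 / 2) l.*2 / (4 ^+ l * l.*2`!%:R).

Lemma pochhammer_gt0 (a : R) k : 0 < a -> 0 < pochhammer a k.
Proof. by move=> a0; apply: prodr_gt0 => i _; rewrite ltr_wpDr. Qed.

(** The coefficient of [U_(2l)] in the expansion of [(1 - s t) `^ (- 3 / 2)] is a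
    power series in [s]; the right-hand side is its coefficient obtained from the
    binomial series and [expr_chebyU].  Both sides satisfy the same first-order
    recurrence in [j]. *)
Lemma hyper_ballot l j : hyper_scale l * hyper_term l j =
  ballot (l + j) l * binom_coef R (l + j).*2.
Proof.
elim: j => [|j IH].
  rewrite /hyper_term !pochhammer0 fact0 !mulr1 divr1 mulr1 addn0.
  rewrite /hyper_scale /binom_coef /ballot addnn binn bin_small// subr0 mul1r.
  by rewrite invfM; ring.
have l0 : 0 <= l%:R :> R by [].
have j0 : 0 <= j%:R :> R by [].
have d n : n.*2%:R = 2 * n%:R :> R by rewrite -mul2n natrM.
have -> : hyper_term l j.+1 = hyper_term l j *
    ((l%:R + 3 / 4 + j%:R) * (l%:R + 5 / 4 + j%:R) / ((2 * l%:R + 2 + j%:R) * (j%:R + 1))).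
  have c0 := @pochhammer_gt0 (l.*2%:R + 2) j ltac:(by rewrite ltr_wpDl).
  rewrite /hyper_term !pochhammerS factS natrM -natr1 d.
  rewrite d in c0; have f0 : 0 < j`!%:R :> R by rewrite ltr0n fact_gt0.
  move: (pochhammer _ j) c0 => P P0; field.
  by rewrite !gt_eqF//; lra.
rewrite mulrA IH addnS doubleS.
have b1 := binom_coefS R (l + j).*2; have b2 := binom_coefS R (l + j).*2.+1.
have bb := @ballotSl (l + j) l (leq_addr _ _).
have e : (l + j - l = j)%N by rewrite addKn.
rewrite e in bb.
have e1 : (l + j + l).+2%:R = 2 * l%:R + 2 + j%:R :> R by rewrite -!natr1 !natrD; ring.
have e2 : (l + j).*2.+1%:R = 2 * (l%:R + j%:R) + 1 :> R by rewrite -natr1 d natrD.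
have e3 : (l + j).*2.+2%:R = 2 * (l%:R + j%:R) + 2 :> R by rewrite -natr1 e2; ring.
rewrite e1 -(natr1 j) e2 e3 in bb; rewrite e2 d natrD in b1; rewrite e3 e2 in b2.
have q0 : 4 * ((j%:R + 1) * (2 * l%:R + 2 + j%:R)) != 0 :> R.
  by rewrite !mulf_neq0// gt_eqF//; lra.
move: b1 b2 bb; set c0 := binom_coef _ _; set c1 := binom_coef _ _.
set c2 := binom_coef _ _ => b1 b2 bb.
apply: (mulfI q0); rewrite [RHS]mulrA bb.
have -> : (2 * (l%:R + j%:R) + 1) * (2 * (l%:R + j%:R) + 2) * ballot (l + j) l * c2 =
  ballot (l + j) l * ((2 * (l%:R + j%:R) + 1) * ((2 * (l%:R + j%:R) + 2) * c2)) by ring.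
rewrite b2 (mulrCA (2 * (l%:R + j%:R) + 1)) b1; field.
by rewrite !gt_eqF//; lra.
Qed.

Definition even_coef (i : nat) : R := binom_coef R i.*2 * moment i.*2.

Lemma hyper_scale_gt0 l : 0 < hyper_scale l.
Proof.
rewrite /hyper_scale divr_gt0 ?mulr_gt0 ?exprn_gt0 ?ltr0n ?fact_gt0//.
by apply: pochhammer_gt0; rewrite divr_gt0.
Qed.

Lemma hyper_termE l j : hyper_term l j =
  (hyper_scale l)^-1 * (ballot (l + j) l * binom_coef R (l + j).*2).
Proof. by rewrite -hyper_ballot mulKf// gt_eqF// hyper_scale_gt0. Qed.

Lemma hyper_term_ge0 l j : 0 <= hyper_term l j.
Proof.
rewrite hyper_termE mulr_ge0 ?invr_ge0 ?(ltW (hyper_scale_gt0 l))//.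
by rewrite mulr_ge0 ?ballot_ge0 ?binom_coef_ge0.
Qed.

Lemma sum_even_le (u : nat -> R) l N : (forall k, 0 <= u k) ->
  \sum_(0 <= j < N) u (l + j).*2 <= \sum_(0 <= k < (l + N).*2) u k.
Proof.
move=> u0; elim: N => [|N IH]; first by rewrite big_geq// sumr_ge0.
rewrite addnS doubleS !big_nat_recr//= -addrA; apply: lerD => //.
by rewrite lerDl.
Qed.

Lemma sum_even_odd0 (u : nat -> R) N : (forall k, u k.*2.+1 = 0) ->
  \sum_(0 <= k < N.*2) u k = \sum_(0 <= i < N) u i.*2.
Proof.
move=> u0; elim: N => [|N IH]; first by rewrite !big_geq.
by rewrite doubleS !big_nat_recr//= IH u0 addr0.
Qed.

Lemma hyper_sum_le l z N : 0 <= z < 1 ->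
  \sum_(0 <= j < N) `|hyper_term l j| * z ^+ (l + j).*2 <=
  (hyper_scale l)^-1 * ((1 - z) `^ (3 / 2))^-1.
Proof.
move=> z01; have /andP[z0 _] := z01.
have s0 : 0 <= (hyper_scale l)^-1 by rewrite invr_ge0 ltW// hyper_scale_gt0.
have b0 k : 0 <= binom_coef R k * z ^+ k by rewrite mulr_ge0 ?binom_coef_ge0 ?exprn_ge0.
apply: (@le_trans _ _ ((hyper_scale l)^-1 *
    \sum_(0 <= j < N) binom_coef R (l + j).*2 * z ^+ (l + j).*2)).
  rewrite big_distrr /=; apply: ler_sum => j _.
  rewrite ger0_norm ?hyper_term_ge0// hyper_termE -(mulrA _ (_ * _)) -(mulrA (ballot _ _)) ler_wpM2l//.
  by rewrite ler_piMl// ballot_le1.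
rewrite ler_wpM2l//; apply: le_trans (binom_sum_le (l + N).*2 z01).
exact: (@sum_even_le (fun k => binom_coef R k * z ^+ k)).
Qed.

Lemma hypergeom2F1E l x : 0 < x ->
  limn (series (fun j => hyper_term l j * mobius x ^+ (l + j).*2)) =
  mobius x ^+ l.*2 * hypergeom2F1 (l.*2%:R / 2 + 3 / 4) (l.*2%:R / 2 + 5 / 4)
                  (l.*2%:R + 2) (mobius x ^+ 2).
Proof.
move=> x0; set s := mobius x.
have s1 : `|s ^+ 2| < 1 by rewrite normrX exprn_ilt1// mobius_lt1.
have bnd j : `|hyper_term l j| <= ((hyper_scale l)^-1 * (l.*2.+2)%:R) * j.+1%:R ^+ 1.
  rewrite ger0_norm ?hyper_term_ge0// hyper_termE -mulrA ler_wpM2l//.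
    by rewrite invr_ge0 ltW// hyper_scale_gt0.
  apply: (@le_trans _ _ (binom_coef R (l + j).*2)).
    by rewrite ler_piMl ?binom_coef_ge0// ballot_le1.
  have /andP[_ h] := binom_coef_itv R (l + j).*2; apply: (le_trans h).
  rewrite expr1 -natrM ler_nat; nia.
have c := is_cvg_pseries_poly bnd s1.
have e : (fun j => hyper_term l j * s ^+ (l + j).*2) =
    s ^+ l.*2 *: (fun j => hyper_term l j * (s ^+ 2) ^+ j).
  apply/funext => j; rewrite doubleD exprD -[in s ^+ j.*2]mul2n exprM.
  by rewrite mulrCA.
rewrite e seriesZ.
have h : s ^+ l.*2 * pseries (hyper_term l) (s ^+ 2) n @[n --> \oo] -->
    s ^+ l.*2 * limn (pseries (hyper_term l) (s ^+ 2)) by apply: cvgMr; exact: c.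
by rewrite (cvg_lim _ h).
Qed.

Lemma powR2_shift l : 2 `^ (l.*2%:R - 3 / 2) = 4 ^+ l / (2 * Num.sqrt 2) :> R.
Proof.
rewrite powRB; last by apply/implyP => _.
rewrite powR_mulrn// powR32// -mul2n exprM expr2 -natrM//.
Qed.

(** The hypergeometric series is integrated termwise; [hyper_ballot] rewrites its
    terms, and the terms with [i < l] vanish. *)
Lemma cvg_dcoef l :
  series (fun i => ballot i l * even_coef i) @ \oo --> (2 * Num.sqrt 2)^-1 * dcoef l.*2.
Proof.
have [int_ c] := @cvg_moment_series R (hyper_term l) (fun j => (l + j).*2) _
  (fun z N => @hyper_sum_le l z N).
have {}c : series (fun j => ballot (l + j) l * even_coef (l + j)) @ \oo -->
    (2 * Num.sqrt 2)^-1 * dcoef l.*2.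
  have -> : series (fun j => ballot (l + j) l * even_coef (l + j)) =
     (fun n => hyper_scale l * series (fun j => hyper_term l j * moment (l + j).*2) n).
    apply/funext => n; rewrite /series /= big_distrr /=; apply: eq_bigr => j _.
    by rewrite mulrA hyper_ballot /even_coef mulrA.
  have -> : (2 * Num.sqrt 2)^-1 * dcoef l.*2 = hyper_scale l *
    \int[mu]_(x in Rpos) (omega_weight x *
      limn (series (fun j => hyper_term l j * mobius x ^+ (l + j).*2))).
    rewrite /dcoef powR2_shift mulrA; congr (_ * _).
      have s2 : Num.sqrt 2 != 0 :> R by rewrite gt_eqF// sqrtr_gt0.
      rewrite /hyper_scale; field.
      by rewrite s2 expf_neq0// pnatr_eq0 -lt0n fact_gt0.
    apply: eq_Rintegral => x; rewrite inE/= in_itv/= andbT => x0.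
    by rewrite hypergeom2F1E// mulrA.
  by apply: cvgMr; exact: c.
rewrite -(cvg_shiftn l).
apply: cvg_trans c; apply: near_eq_cvg; apply: nearW => n.
rewrite /series /= [RHS](@big_cat_nat _ _ _ l)//= ?leq_addl//.
rewrite [X in _ = X + _]big1_seq ?add0r; last first.
  move=> i; rewrite mem_index_iota => /andP[_ /andP[_ il]].
  by rewrite ballot_small ?mul0r.
by rewrite -[X in _ = \sum_(X <= i < _) _](add0n l) big_addn addnK;
  apply: eq_bigr => i _; rewrite addnC.
Qed.

(** Here [x + (1 - t) / (1 + t)] equals [(x + 1) (1 + t * mobius x) / (1 + t)], and
    the powers of [1 + t] cancel. *)
Lemma tnu_integral t : -1 < t < 1 ->
  tnu t = \int[mu]_(x in Rpos) (omega_weight x *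
    limn (series (fun k => binom_coef R k * (- t) ^+ k * mobius x ^+ k))).
Proof.
move=> /andP[t1 t2]; have t10 : 0 < 1 + t by lra.
have p0 := powR_gt0 (3 / 2) t10.
have tm x : 0 < x -> `|t * mobius x| <= `|mobius x|.
  by move=> x0; rewrite normrM ler_piMl// ler_norml !ltW.
have tm1 x : 0 < x -> 0 < 1 + t * mobius x.
  move=> x0; have := le_lt_trans (tm x x0) (mobius_lt1 x0).
  by rewrite ltr_norml => /andP[+ _]; lra.
pose f x := omega_weight x * ((1 + t * mobius x) `^ (3 / 2))^-1.
have intf : mu.-integrable Rpos (EFin \o f).
  apply: (@integrable_le_majorant _ _ 1) => x x0.
    apply: cvgM; first exact: continuous_omega_weight.
    apply: cvgV; first by rewrite gt_eqF// powR_gt0// tm1.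
    apply: (@continuous_cvg _ _ _ _ _ (fun x => 1 + t * mobius x) (@powR R ^~ (3 / 2))).
      by apply: continuous_powR_gt0; exact: tm1.
    apply: cvgD; first exact: cvg_cst.
    by apply: cvgMr; exact: continuous_mobius.
  rewrite mul1r /f /moment_majorant normrM ler_wpM2l//.
  rewrite normfV (ger0_norm (powR_ge0 _ _)) lef_pV2 ?posrE ?powR_gt0 ?tm1//; last first.
    by rewrite subr_gt0 mobius_lt1.
  apply: ge0_ler_powR; rewrite ?nnegrE ?divr_ge0// ?(ltW (tm1 _ x0))//.
    by rewrite subr_ge0 ltW// mobius_lt1.
  have := tm x x0; rewrite ler_norml => /andP[+ _]; lra.
have -> : tnu t = \int[mu]_(x in Rpos) f x.
  rewrite /tnu /nu; apply: (mulfI (lt0r_neq0 p0)).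
  rewrite (mulVKf (lt0r_neq0 p0)).
  have mRpos : measurable Rpos by exact: measurable_itv.
  rewrite -(RintegralZl ((1 + t) `^ (3 / 2)) mRpos intf).
  apply: eq_Rintegral => x; rewrite inE/= in_itv/= andbT => x0.
  have x10 : 0 < x + 1 by rewrite ltr_wpDr// ltW.
  have -> : x + (1 - t) / (1 + t) = (x + 1) * (1 + t * mobius x) / (1 + t).
    by rewrite /mobius; field; rewrite !gt_eqF.
  rewrite !powRM ?invr_ge0 ?mulr_ge0 ?(ltW x10) ?(ltW t10) ?(ltW (tm1 _ x0))//.
  have -> : (1 + t)^-1 `^ (3 / 2) = ((1 + t) `^ (3 / 2))^-1.
    by rewrite -powR_inv1 ?(ltW t10)// -powRrM mulN1r powRN.
  have p1 := powR_gt0 (3 / 2) x10; have p2 := powR_gt0 (3 / 2) (tm1 _ x0).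
  by rewrite /f /omega_weight; field; rewrite !gt_eqF.
apply: eq_Rintegral => x; rewrite inE/= in_itv/= andbT => x0.
rewrite /f; congr (_ * _).
have h : `|- (t * mobius x)| < 1 by rewrite normrN (le_lt_trans (tm x x0))// mobius_lt1.
have := cvg_binom_series h; rewrite opprK => c; rewrite -(cvg_lim _ c)//.
congr (limn (series _)); apply/funext => k.
by rewrite -mulNr exprMn mulrA.
Qed.

(** The odd moments vanish, so the partial sums of even order of the binomial
    expansion involve even powers only. *)
Lemma cvg_even_coef t : -1 < t < 1 ->
  series (fun i => even_coef i * t ^+ i.*2) @ \oo --> tnu t.
Proof.
move=> t01; have /andP[t1 t2] := t01.
have dom z N : 0 <= z < 1 ->
    \sum_(0 <= j < N) `|binom_coef R j * (- t) ^+ j| * z ^+ j <=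
    1 * ((1 - z) `^ (3 / 2))^-1.
  move=> z01; have /andP[z0 _] := z01.
  rewrite mul1r; apply: le_trans (binom_sum_le N z01); apply: ler_sum => j _.
  rewrite ler_wpM2r ?exprn_ge0// normrM ger0_norm ?binom_coef_ge0//.
  rewrite ler_piMr ?binom_coef_ge0// normrX normrN exprn_ile1//.
  by rewrite ler_norml !ltW.
have [_] := @cvg_moment_series R _ id 1 dom; rewrite -tnu_integral// => c.
have d : (fun N => N.*2) n @[n --> \oo] --> \oo.
  move=> P [M _ hM]; exists M => // n /= Mn; apply: hM => /=; lia.
have := cvg_comp _ _ d c.
apply: cvg_trans; apply: near_eq_cvg; apply: nearW => N.
rewrite /= /series /= sum_even_odd0 => [|k].
  apply: eq_bigr => k _; rewrite /even_coef exprNn -signr_odd odd_double expr0 mul1r.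
  by rewrite mulrAC.
by rewrite (@moment_odd R k.*2.+1) ?mulr0//= odd_double.
Qed.

Lemma is_cvg_even_coef : cvgn (series (fun i => `|even_coef i|)).
Proof.
apply: nondecreasing_is_cvgn.
  by apply/nondecreasing_seqP => n; rewrite /series /= big_nat_recr//= lerDl.
have c := @is_cvg_binom_moment R.
exists (limn (series (fun k => binom_coef R k * `|moment k|))) => _ [n _ <-].
have b0 k : 0 <= binom_coef R k * `|@moment R k| by rewrite mulr_ge0// binom_coef_ge0.
apply: (@le_trans _ _ (series (fun k => binom_coef R k * `|moment k|) n.*2)).
  rewrite /series /=; under eq_bigr do rewrite normrM (ger0_norm (binom_coef_ge0 _ _)).
  exact: (@sum_even_le (fun k => binom_coef R k * `|moment k|) 0).
apply: nondecreasing_cvgn_le => //.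
by apply/nondecreasing_seqP => k; rewrite /series /= big_nat_recr//= lerDl.
Qed.

Definition even_tail (N : nat) : R :=
  limn (series (fun i => `|even_coef i|)) - series (fun i => `|even_coef i|) N.

Lemma cvg_even_tail : even_tail N @[N --> \oo] --> (0 : R).
Proof.
rewrite -(subrr (limn (series (fun i => `|even_coef i|)))).
by apply: cvgB; [exact: cvg_cst|exact: is_cvg_even_coef].
Qed.

(** Exchange the two summations, truncated at [P] in the index [i]: for [i < N] the
    inner sum is [t ^+ (2 i)] by [expr_chebyU]; for [i >= N] both the inner sum and
    [t ^+ (2 i)] are at most [1] in absolute value, by [sum_ballot_le]. *)
Lemma cheby_partial_sum_close t N : -1 < t < 1 ->
  `|tnu t - cheby_partial_sum N t| <= 2 * even_tail N.
Proof.
move=> t01; have /andP[t1 t2] := t01.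
pose X P := \sum_(0 <= l < N) series (fun i => ballot i l * even_coef i) P *
  (chebyU l.*2).[t].
pose Y P := series (fun i => even_coef i * t ^+ i.*2) P.
have cX : X P @[P --> \oo] --> cheby_partial_sum N t.
  rewrite /X /cheby_partial_sum big_distrr /=.
  elim: (N) => [|L IH].
    by rewrite big_geq//; under eq_fun do rewrite big_geq//; exact: cvg_cst.
  rewrite big_nat_recr//=; under eq_fun do rewrite big_nat_recr//=.
  by apply: cvgD => //; rewrite mulrA; apply: cvgMl; exact: cvg_dcoef.
have cY : Y P @[P --> \oo] --> tnu t by exact: cvg_even_coef.
have c : `|Y P - X P| @[P --> \oo] --> `|tnu t - cheby_partial_sum N t|.
  by apply: cvg_norm; apply: cvgB.
apply: (cvgr_to_le c); near=> P.
have NP : (N <= P)%N by near: P; exists N.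
have XE : X P = \sum_(0 <= i < P) even_coef i *
    (\sum_(0 <= l < N) ballot i l * (chebyU l.*2).[t]).
  rewrite /X /series /=; under eq_bigr do rewrite big_distrl /=.
  rewrite exchange_big_nat /=; apply: eq_bigr => i _; rewrite big_distrr /=.
  by apply: eq_bigr => l _; ring.
rewrite XE /Y /series /= -sumrB.
under eq_bigr do rewrite -mulrBr.
rewrite (@big_cat_nat _ _ _ N)//= big1_seq ?add0r; last first.
  move=> i; rewrite mem_index_iota => /andP[_ /andP[_ iN]].
  suff -> : \sum_(0 <= l < N) ballot i l * (chebyU l.*2).[t] = t ^+ i.*2.
    by rewrite subrr mulr0.
  rewrite expr_chebyU (@big_cat_nat _ _ _ i.+1)//= [X in _ + X]big1_seq ?addr0// => l.
  rewrite mem_index_iota => /andP[_ /andP[il _]].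
  by rewrite ballot_small ?mul0r.
apply: (le_trans (ler_norm_sum _ _ _)).
apply: (@le_trans _ _ (\sum_(N <= i < P) 2 * `|even_coef i|)).
  apply: ler_sum => i _; rewrite normrM mulrC ler_wpM2r//.
  apply: (le_trans (ler_normB _ _)).
  have -> : 2 = 1 + 1 :> R by [].
  apply: lerD; first by rewrite normrX exprn_ile1// ler_norml !ltW.
  apply: (le_trans (ler_norm_sum _ _ _)); apply: le_trans (sum_ballot_le i N).
  apply: ler_sum => l _; rewrite normrM ger0_norm ?ballot_ge0//.
  by rewrite ler_wpM2l ?ballot_ge0// norm_chebyU_le.
rewrite -big_distrr /= ler_wpM2l// /even_tail -sub_series_geq// lerD2r.
apply: nondecreasing_cvgn_le; last exact: is_cvg_even_coef.
by apply/nondecreasing_seqP => k; rewrite /series /= big_nat_recr//= lerDl.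
Unshelve. all: by end_near. Qed.

End expansion.

(** * Convergence in the weighted norm *)

Section L2.
Context {R : realType}.
Local Notation mu := (@lebesgue_measure R).
Local Notation I11 := (`](-1)%R, 1%R[%classic : set R).

Lemma continuous_cheby_partial_sum N : continuous (@cheby_partial_sum R N).
Proof.
move=> t; apply: cvgMr.
elim: N => [|N IH].
  by rewrite big_geq//; under eq_fun do rewrite big_geq//; exact: cvg_cst.
rewrite big_nat_recr//=; under eq_fun do rewrite big_nat_recr//=.
by apply: cvgD => //; apply: cvgMr; exact: continuous_horner.
Qed.

Lemma cvg_cheby_partial_sum (t : R) : -1 < t < 1 ->
  cheby_partial_sum N t @[N --> \oo] --> tnu t.
Proof.
move=> t1; apply/cvgrPdist_le => e e0.
have /cvgrPdist_le/(_ (e / 2)) := @cvg_even_tail R.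
rewrite divr_gt0// => /(_ isT) h; near=> N.
apply: (le_trans (cheby_partial_sum_close N t1)).
have : `|0 - even_tail N| <= e / 2 :> R by near: N; exact: h.
by rewrite sub0r normrN => /(le_trans (ler_norm _)); lra.
Unshelve. all: by end_near. Qed.

Lemma measurable_tnu : measurable_fun I11 (@tnu R).
Proof.
apply: (@measurable_fun_cvg _ _ _ _ (@cheby_partial_sum R)).
  move=> N; apply: measurable_funTS.
  exact: continuous_measurable_fun (@continuous_cheby_partial_sum N).
by move=> t; rewrite /= in_itv/=; exact: cvg_cheby_partial_sum.
Qed.

(** The weight is at most [1], on an interval of length [2]. *)
Lemma chebyL2norm_le (f : R -> R) (B : R) : measurable_fun I11 f ->
  0 <= B -> (forall t, -1 < t < 1 -> `|f t| <= B) ->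
  (0 <= chebyL2norm f <= (Num.sqrt 2 * B)%:E)%E.
Proof.
move=> mf B0 fB; rewrite /chebyL2norm poweR_ge0 /=.
have -> : ((Num.sqrt 2 * B)%:E = ((B ^+ 2 * 2)%:E `^ 2^-1))%E.
  rewrite poweR_EFin powR12_sqrt ?mulr_ge0 ?sqr_ge0// sqrtrM ?sqr_ge0//.
  by rewrite sqrtr_sqr ger0_norm// mulrC.
have nn (t : R) : 0 <= `|f t| ^+ 2 * Num.sqrt (1 - t ^+ 2).
  by rewrite mulr_ge0 ?sqr_ge0 ?sqrtr_ge0.
apply: gt0_ler_poweR.
- by rewrite invr_ge0.
- by rewrite in_itv/= leey andbT integral_ge0// => t _; rewrite lee_fin.
- by rewrite in_itv/= leey andbT lee_fin mulr_ge0 ?sqr_ge0.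
apply: (@le_trans _ _ (\int[mu]_(t in `](-1)%R, 1%R[) (B ^+ 2)%:E)%E).
  apply: ge0_le_integral => //.
  - apply/measurable_EFinP; apply: measurable_funM.
      by apply: measurable_funX; apply: measurableT_comp => //; exact: normr_measurable.
    apply: measurable_funTS; apply: continuous_measurable_fun => t.
    apply: (@continuous_cvg _ _ _ _ _ (fun t : R => 1 - t ^+ 2) (@Num.sqrt R)).
      exact: sqrt_continuous.
    by apply: cvgB; [exact: cvg_cst|exact: exprn_continuous].
  - move=> t; rewrite /= in_itv/= => t1; rewrite lee_fin.
    rewrite -[leRHS]mulr1; apply: ler_pM; rewrite ?sqr_ge0 ?sqrtr_ge0//.
      by apply: lerXn2r; rewrite ?nnegrE// fB.
    by rewrite -[leRHS]sqrtr1 ler_sqrt// gerBl sqr_ge0.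
rewrite integral_cst//= lebesgue_measure_itv/= lte_fin gtrN// -EFinB -EFinM.
by rewrite opprK lexx.
Qed.

Lemma chebyL2norm_cvg0 :
  chebyL2norm (fun t : R => tnu t - cheby_partial_sum N t) @[N --> \oo] --> 0%E.
Proof.
have h0 : (Num.sqrt 2 * (2 * @even_tail R N))%:E @[N --> \oo] --> (0%:E : \bar R).
  apply: cvg_EFin; first by near=> N.
  rewrite -[X in _ --> X](mulr0 (Num.sqrt 2 : R)) -[X in _ * X](mulr0 2).
  by apply: cvgMr; apply: cvgMr; exact: cvg_even_tail.
apply: (squeeze_cvge _ (cvg_cst 0%E) h0); near=> N.
apply: chebyL2norm_le.
- apply: measurable_funB; first exact: measurable_tnu.
  apply: measurable_funTS.
  exact: continuous_measurable_fun (@continuous_cheby_partial_sum N).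
- have := @cheby_partial_sum_close R 0 N; rewrite oppr_lt0 ltr01 => /(_ isT).
  exact: le_trans.
- by move=> t; exact: cheby_partial_sum_close.
Unshelve. all: by end_near. Qed.

Lemma in_chebyL2_tnu : in_chebyL2 (@tnu R).
Proof.
split; first exact: measurable_tnu.
have close (t : R) : -1 < t < 1 -> `|tnu t| <= 2 * @even_tail R 0.
  move=> t1; have := cheby_partial_sum_close 0 t1.
  by rewrite /cheby_partial_sum big_geq// mulr0 subr0.
have B0 : 0 <= 2 * @even_tail R 0.
  by apply: le_trans (close 0 _); rewrite // oppr_lt0 ltr01.
have /andP[_ h] := chebyL2norm_le measurable_tnu B0 close.
by apply: le_lt_trans h _; rewrite ltry.
Qed.

End L2.

Unset Implicit Arguments.

Theorem theorem5p9 (R : realType) :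
  (forall t : R, -1 < t < 1 ->
     cheby_partial_sum N t @[N --> \oo] --> tnu t) /\
  (in_chebyL2 (@tnu R) /\
   chebyL2norm (fun t : R => tnu t - cheby_partial_sum N t) @[N --> \oo]
     --> 0%E).
Proof.
split; first exact: cvg_cheby_partial_sum.
split; [exact: in_chebyL2_tnu|exact: chebyL2norm_cvg0].
Qed.
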